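(* Let $Y_1,\dots,Y_q$ be locally Lipschitz vector fields on $\mathbb{R}^n$ satisfying condition (H), and let $\Omega\subset\mathbb{R}^n$ be bounded. Then there is $C>0$ such that for every $x\in\Omega$, every subunit path $\gamma:[0,T]\to\mathbb{R}^n$ with $\gamma(0)=x$, and every $p\in\{1,\dots,\min\{q,n\}\}$, $$|\Lambda_p(\gamma(t))-\Lambda_p(x)|\le|\Lambda_p(x)|(e^{Ct}-1)\quad\text{for all }t\in[0,\min\{T,C^{-1}\}].$$ In particular, for every $I\in\mathcal{I}(p,q)$, $$|Y_I(\gamma(t))-Y_I(x)|\le C|\Lambda_p(x)|(e^{Ct}-1)\quad\text{for all }t\in[0,\min\{T,C^{-1}\}].$$
   Context: $Y_j=\sum_\alpha g_j^\alpha\partial_\alpha$ with $g_j$ locally Lipschitz. Condition (H): for every bounded open $\Omega'$ there is $C_{\Omega'}$ with $(Y_jg_k(x)-Y_kg_j(x))\cdot\nabla\in\{\sum_i c_iY_i(x):|c|\le C_{\Omega'}\}$ for a.e. $x\in\Omega'$, all $j,k$ (with $Y_jg_k=Dg_k\,g_j$, a.e.). Subunit path: Lipschitz $\gamma$ with $\dot\gamma=\sum_ju_j(t)Y_j(\gamma)$ a.e., $|u(t)|\le1$ a.e. For $1\le p\le\mu$, $\mathcal{I}(p,\mu):=\{(i_1,\dots,i_p):1\le i_1<\dots<i_p\le\mu\}$. For $I\in\mathcal{I}(p,q)$, $Y_I(x):=Y_{i_1}(x)\wedge\cdots\wedge Y_{i_p}(x)\in\bigwedge_p\mathbb{R}^n$,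 and for $K\in\mathcal{I}(p,n)$, $Y_I^K(x):=\det\big(g_{i_b}^{k_a}(x)\big)_{a,b=1}^p$, so that $Y_I=\sum_K Y_I^Ke_K$ with $\{e_K=e_{k_1}\wedge\dots\wedge e_{k_p}\}$ orthonormal and $|Y_I|^2=\sum_K(Y_I^K)^2$. $\Lambda_p(x):=(Y_J^K(x))_{J\in\mathcal{I}(p,q),K\in\mathcal{I}(p,n)}$ with Euclidean norm $|\Lambda_p(x)|^2=\sum_{J,K}Y_J^K(x)^2$. *)

(* Defs.v *)
From mathcomp Require Import all_boot all_fingroup.
From Stdlib Require Import Reals.
Set Implicit Arguments. Unset Strict Implicit. Unset Printing Implicit Defensive.
Local Open Scope R_scope.

Definition norm2 {n : nat} (x : 'I_n -> R) : R :=
  sqrt (\big[Rplus/0]_(i < n) (x i ^ 2)).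

Definition vsub {n : nat} (x y : 'I_n -> R) : 'I_n -> R := fun i => x i - y i.

Definition null_set (n : nat) (N : ('I_n -> R) -> Prop) : Prop :=
  forall eps, 0 < eps -> exists a b : nat -> 'I_n -> R,
    (forall k i, a k i <= b k i) /\
    (forall x, N x -> exists k, forall i, a k i <= x i <= b k i) /\
    (forall m, \big[Rplus/0]_(k < m) \big[Rmult/1]_(i < n) (b k i - a k i) < eps).

Definition null1 (N : R -> Prop) : Prop := null_set (fun v : 'I_1 -> R => N (v ord0)).

Definition is_bounded {n : nat} (Om : ('I_n -> R) -> Prop) : Prop :=
  exists M, forall x, Om x -> norm2 x <= M.

Definition is_open {n : nat} (Om : ('I_n -> R) -> Prop) : Prop :=
  forall x, Om x -> exists r, 0 < r /\ forall y, norm2 (vsub y x) < r -> Om y.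

Definition loc_lip {n : nat} (f : ('I_n -> R) -> ('I_n -> R)) : Prop :=
  forall x0, exists r L, 0 < r /\
    forall y z, norm2 (vsub y x0) < r -> norm2 (vsub z x0) < r ->
      norm2 (vsub (f y) (f z)) <= L * norm2 (vsub y z).

Definition frechet {n : nat} (f : ('I_n -> R) -> ('I_n -> R)) (x : 'I_n -> R)
  (D : 'I_n -> 'I_n -> R) : Prop :=
  forall eps, 0 < eps -> exists delta, 0 < delta /\
    forall y, norm2 (vsub y x) < delta ->
      norm2 (fun a => f y a - f x a - \big[Rplus/0]_(b < n) (D a b * (y b - x b)))
        <= eps * norm2 (vsub y x).

(* Condition (H).  Y_j = sum_a g j a d_a ; Y_j g_k = (Dg_k) g_j (a.e.). *)
Definition condH {q n : nat} (g : 'I_q -> ('I_n -> R) -> ('I_n -> R)) : Prop :=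
  forall Om : ('I_n -> R) -> Prop, is_open Om -> is_bounded Om ->
  exists C : R, null_set (fun x => Om x /\ ~ (forall j k : 'I_q,
      exists Dj Dk, frechet (g j) x Dj /\ frechet (g k) x Dk /\
      exists c : 'I_q -> R, norm2 c <= C /\
        forall a : 'I_n,
          \big[Rplus/0]_(b < n) (Dk a b * g j x b - Dj a b * g k x b)
          = \big[Rplus/0]_(i < q) (c i * g i x a))).

Definition subunit {q n : nat} (g : 'I_q -> ('I_n -> R) -> ('I_n -> R))
  (T : R) (gam : R -> 'I_n -> R) : Prop :=
  (exists L, forall s t, 0 <= s <= T -> 0 <= t <= T ->
      norm2 (vsub (gam s) (gam t)) <= L * Rabs (s - t)) /\
  null1 (fun t => 0 <= t <= T /\ ~ exists u : 'I_q -> R, norm2 u <= 1 /\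
      forall a : 'I_n, derivable_pt_lim (fun s => gam s a) t
                         (\big[Rplus/0]_(j < q) (u j * g j (gam t) a))).

Definition incr_idx {p m : nat} (I : p.-tuple 'I_m) : bool :=
  sorted (fun a b : 'I_m => ltn a b) I.

Definition detR {p : nat} (A : 'I_p -> 'I_p -> R) : R :=
  \big[Rplus/0]_(s : 'S_p)
     ((if odd_perm s then -1 else 1) * \big[Rmult/1]_(a < p) A a (s a)).

Definition YIK {q n p : nat} (g : 'I_q -> ('I_n -> R) -> ('I_n -> R))
  (I : p.-tuple 'I_q) (K : p.-tuple 'I_n) (x : 'I_n -> R) : R :=
  detR (fun a b : 'I_p => g (tnth I b) x (tnth K a)).

Definition LamNorm {q n : nat} (g : 'I_q -> ('I_n -> R) -> ('I_n -> R)) (p : nat)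
  (x : 'I_n -> R) : R :=
  sqrt (\big[Rplus/0]_(J : p.-tuple 'I_q | incr_idx J)
          \big[Rplus/0]_(K : p.-tuple 'I_n | incr_idx K) (YIK g J K x ^ 2)).

Definition LamDiff {q n : nat} (g : 'I_q -> ('I_n -> R) -> ('I_n -> R)) (p : nat)
  (y x : 'I_n -> R) : R :=
  sqrt (\big[Rplus/0]_(J : p.-tuple 'I_q | incr_idx J)
          \big[Rplus/0]_(K : p.-tuple 'I_n | incr_idx K)
             ((YIK g J K y - YIK g J K x) ^ 2)).

(* |Y_I(y) - Y_I(x)| in the orthonormal basis e_K of Lambda_p R^n *)
Definition YIDiff {q n p : nat} (g : 'I_q -> ('I_n -> R) -> ('I_n -> R))
  (I : p.-tuple 'I_q) (y x : 'I_n -> R) : R :=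
  sqrt (\big[Rplus/0]_(K : p.-tuple 'I_n | incr_idx K)
          ((YIK g I K y - YIK g I K x) ^ 2)).

(* Main.v *)
From Stdlib Require Import Reals Lra Classical IndefiniteDescription FunctionalExtensionality.
From Coquelicot Require Import Coquelicot.
Require Import Defs.
From mathcomp Require Import all_boot all_fingroup ssralg ssrnum matrix Rstruct.
Set Implicit Arguments. Unset Strict Implicit. Unset Printing Implicit Defensive.
Local Open Scope R_scope.

(** At a point where (H) holds, let [G] be the matrix of the fields.  Along a combination of the
    fields (H) says that [G' = X G + G Y] with [X] and [Y] bounded: [X] comes from the Jacobians and
    [Y] from the coefficients of the brackets.  Expanding along rows for [X G] and along columns for
    [G Y], the derivative of a [p]-minor of [G] is again a bounded combination of [p]-minors, so
    [|Lambda_p|' <= C |Lambda_p|] and Gronwall's inequality applies.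
    A subunit path may however run entirely inside the null set where (H) fails.  We therefore
    translate it by a small vector [y]: covering the null set by boxes of small total volume
    and averaging over [y], one coordinate at a time, some translate spends arbitrarily little
    time in the boxes.  Along that translate the derivative bound holds up to [O(|y|)] outside
    a set of times of small measure, on which Lipschitz continuity suffices; this gives
    Gronwall's inequality with a small error, and then [y] tends to [0]. *)

(** * Finite sums and Euclidean norms *)

Section SumR.
Variables (I : Type) (r : seq I) (P : pred I).
Implicit Types F G : I -> R.

Lemma sumR_ge0 F : (forall i, P i -> 0 <= F i) -> 0 <= \big[Rplus/0]_(i <- r | P i) F i.
Proof. by move=> F0; apply/RleP/Num.Theory.sumr_ge0 => i /F0 /RleP. Qed.

Lemma prodR_ge0 F : (forall i, P i -> 0 <= F i) -> 0 <= \big[Rmult/1]_(i <- r | P i) F i.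
Proof. by move=> F0; apply/RleP/Num.Theory.prodr_ge0 => i /F0 /RleP. Qed.

Lemma ler_sumR F G : (forall i, P i -> F i <= G i) ->
  \big[Rplus/0]_(i <- r | P i) F i <= \big[Rplus/0]_(i <- r | P i) G i.
Proof. by move=> FG; apply/RleP/Num.Theory.ler_sum => i /FG /RleP. Qed.

Lemma Rabs_sumR F :
  Rabs (\big[Rplus/0]_(i <- r | P i) F i) <= \big[Rplus/0]_(i <- r | P i) Rabs (F i).
Proof. by apply/RleP; exact: (Num.Theory.ler_norm_sum r F P). Qed.

Lemma sumRB F G :
  \big[Rplus/0]_(i <- r | P i) (F i - G i) =
  \big[Rplus/0]_(i <- r | P i) F i - \big[Rplus/0]_(i <- r | P i) G i.
Proof. exact: (GRing.sumrB r P F G). Qed.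

End SumR.

Section FinSumR.
Variables (I : finType) (P : pred I).
Implicit Types F : I -> R.

Lemma sumR_le_card F c : 0 <= c -> (forall i, P i -> F i <= c) ->
  \big[Rplus/0]_(i | P i) F i <= INR #|I| * c.
Proof.
move=> c_ge0 Fc; apply: (@Rle_trans _ (\big[Rplus/0]_(i : I) c)).
  by rewrite big_mkcond; apply: ler_sumR => i _; case: ifP => [/Fc|].
by apply: Req_le; rewrite INRE (GRing.sumr_const I c) RmultE GRing.mulr_natl.
Qed.

Lemma sumR_ge_term F i : (forall j, P j -> 0 <= F j) -> P i -> F i <= \big[Rplus/0]_(j | P j) F j.
Proof.
move=> F0 Pi; rewrite (bigD1 i) //=.
have : 0 <= \big[Rplus/0]_(j | P j && (j != i)) F j by apply: sumR_ge0 => j /andP[/F0].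
by lra.
Qed.

End FinSumR.

Lemma Rabs_sumR_le_ord m (F : 'I_m -> R) c : 0 <= c -> (forall i, Rabs (F i) <= c) ->
  Rabs (\big[Rplus/0]_(i < m) F i) <= INR m * c.
Proof.
move=> c_ge0 Fc; rewrite -[X in INR X * _]card_ord; apply: Rle_trans (Rabs_sumR _ _ _) _.
exact: sumR_le_card.
Qed.

Lemma sumR_mono (F : nat -> R) (m m' : nat) : (forall k, 0 <= F k) -> leq m m' ->
  \big[Rplus/0]_(k < m) F k <= \big[Rplus/0]_(k < m') F k.
Proof.
move=> F0 mm'; rewrite -!(big_mkord xpredT) (big_cat_nat (leq0n m) mm') /=.
by have := @sumR_ge0 _ (index_iota m m') xpredT F (fun k _ => F0 k); lra.
Qed.

Lemma exists_common_bound (I : finType) (Q : I -> R -> Prop) :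
  (forall i c c', c <= c' -> Q i c -> Q i c') -> (forall i, exists c, Q i c) ->
  exists c, 0 <= c /\ forall i, Q i c.
Proof.
move=> mono /functional_choice [c Qc].
exists (\big[Rplus/0]_i Rabs (c i)); split=> [|i].
  by apply: sumR_ge0 => i _; exact: Rabs_pos.
apply: mono (Qc i); apply: Rle_trans (Rle_abs _) _.
exact: (@sumR_ge_term _ xpredT (fun i => Rabs (c i)) i (fun _ _ => Rabs_pos _)).
Qed.

Lemma Rabs_mult_le x y a b : Rabs x <= a -> Rabs y <= b -> Rabs (x * y) <= a * b.
Proof. by move=> xa yb; rewrite Rabs_mult; apply: Rmult_le_compat => //; exact: Rabs_pos. Qed.

Section L2.
Variables (I : finType) (P : pred I).
Implicit Types f h : I -> R.

Definition l2 f : R := sqrt (\big[Rplus/0]_(i | P i) (f i ^ 2)).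

Lemma l2_ge0 f : 0 <= l2 f.
Proof. exact: sqrt_pos. Qed.

Lemma l2_sqr f : l2 f ^ 2 = \big[Rplus/0]_(i | P i) (f i ^ 2).
Proof. by rewrite pow2_sqrt //; apply: sumR_ge0 => i _; exact: pow2_ge_0. Qed.

Lemma eq_l2 f h : (forall i, P i -> f i = h i) -> l2 f = l2 h.
Proof. by move=> fh; congr sqrt; apply: eq_bigr => i /fh ->. Qed.

Lemma l2_eq0 f : (forall i, P i -> f i = 0) -> l2 f = 0.
Proof. by move=> f0; rewrite /l2 big1 ?sqrt_0 // => i /f0 ->; ring. Qed.

Lemma Rabs_le_l2 f i : P i -> Rabs (f i) <= l2 f.
Proof.
move=> Pi; rewrite -sqrt_Rsqr_abs Rsqr_pow2; apply: sqrt_le_1_alt.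
exact: (@sumR_ge_term _ P (fun i => f i ^ 2) i (fun _ _ => pow2_ge_0 _)).
Qed.

Lemma l2Z c f : l2 (fun i => c * f i) = Rabs c * l2 f.
Proof.
rewrite -sqrt_Rsqr_abs Rsqr_pow2 -sqrt_mult_alt; last exact: pow2_ge_0.
by congr sqrt; rewrite big_distrr /=; apply: eq_bigr => i _; ring.
Qed.

Lemma l2_sqrD f h :
  l2 (fun i => f i + h i) ^ 2 =
  l2 f ^ 2 + 2 * \big[Rplus/0]_(i | P i) (f i * h i) + l2 h ^ 2.
Proof. by rewrite !l2_sqr big_distrr /= -!big_split /=; apply: eq_bigr => i _; ring. Qed.

Lemma Cauchy_Schwarz f h : \big[Rplus/0]_(i | P i) (f i * h i) <= l2 f * l2 h.
Proof.
have coord0 u i : l2 u = 0 -> P i -> u i = 0.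
  move=> u0 Pi; apply: Rabs_eq_0.
  by have := Rabs_le_l2 u Pi; have := Rabs_pos (u i); lra.
have [f0|f0] := Req_dec (l2 f) 0.
  by rewrite f0 big1 => [|i /(coord0 f i f0) ->]; lra.
have [h0|h0] := Req_dec (l2 h) 0.
  by rewrite h0 big1 => [|i /(coord0 h i h0) ->]; lra.
have := pow2_ge_0 (l2 (fun i => l2 h * f i + - l2 f * h i)).
rewrite l2_sqrD !l2Z Rabs_Ropp !Rabs_pos_eq; try exact: l2_ge0.
rewrite (eq_bigr (fun i => - (l2 f * l2 h) * (f i * h i))) => [|i _]; last by ring.
rewrite -big_distrr /= => sqr_ge0.
apply: (Rmult_le_reg_l (l2 f * l2 h)); last lra.
by apply: Rmult_lt_0_compat; have := l2_ge0 f; have := l2_ge0 h; lra.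
Qed.

Lemma l2_triangle f h : l2 (fun i => f i + h i) <= l2 f + l2 h.
Proof.
have f0 := l2_ge0 f; have h0 := l2_ge0 h.
apply: Rsqr_incr_0_var; last lra.
by rewrite !Rsqr_pow2 l2_sqrD; have := Cauchy_Schwarz f h; nra.
Qed.

Lemma l2N f : l2 (fun i => - f i) = l2 f.
Proof. by rewrite /l2; congr sqrt; apply: eq_bigr => i _; ring. Qed.

Lemma l2_le_card f c : 0 <= c -> (forall i, P i -> Rabs (f i) <= c) -> l2 f <= INR #|I| * c.
Proof.
move=> c_ge0 fc; have cardc := Rmult_le_pos _ _ (pos_INR #|I|) c_ge0.
apply: Rsqr_incr_0_var => //; rewrite !Rsqr_pow2 l2_sqr.
apply: (@Rle_trans _ (INR #|I| * c ^ 2)).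
  apply: sumR_le_card => [|i /fc fi]; first exact: pow2_ge_0.
  by rewrite -pow2_abs; apply: pow_incr; split=> //; exact: Rabs_pos.
case: #|I| => [|m]; first by rewrite /=; lra.
have : 1 <= INR m.+1 by rewrite S_INR; have := pos_INR m; lra.
by nra.
Qed.

End L2.

Section Norm2.
Variable n : nat.
Implicit Types x y z : 'I_n -> R.

Lemma norm2_ge0 x : 0 <= norm2 x.
Proof. exact: sqrt_pos. Qed.

Lemma Rabs_le_norm2 x i : Rabs (x i) <= norm2 x.
Proof. exact: (Rabs_le_l2 (P := xpredT)). Qed.

Lemma norm2_le_dim x c : 0 <= c -> (forall i, Rabs (x i) <= c) -> norm2 x <= INR n * c.
Proof.
move=> c_ge0 xc; rewrite -[X in INR X * _]card_ord.
exact: (@l2_le_card _ xpredT).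
Qed.

Lemma norm2_triangle x y z : norm2 (vsub x z) <= norm2 (vsub x y) + norm2 (vsub y z).
Proof.
apply: Rle_trans (l2_triangle xpredT _ _); apply: Req_le.
by apply: (@eq_l2 _ xpredT) => i _; rewrite /vsub; ring.
Qed.

Lemma norm2_vsub_le x y : norm2 x <= norm2 (vsub x y) + norm2 y.
Proof.
apply: Rle_trans (l2_triangle xpredT _ _); apply: Req_le.
by apply: (@eq_l2 _ xpredT) => i _; rewrite /vsub; ring.
Qed.

Lemma norm2_vsubC x y : norm2 (vsub x y) = norm2 (vsub y x).
Proof. by rewrite -[LHS](@l2N _ xpredT); apply: (@eq_l2 _ xpredT) => i _; rewrite /vsub; ring. Qed.

Lemma norm2_vsubxx x : norm2 (vsub x x) = 0.
Proof. by apply: (@l2_eq0 _ xpredT) => i _; rewrite /vsub; ring. Qed.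

End Norm2.

Section LambdaNorms.
Variables (q n : nat) (g : 'I_q -> ('I_n -> R) -> ('I_n -> R)) (p : nat).
Implicit Types x y z : 'I_n -> R.

Definition incr_pair (JK : p.-tuple 'I_q * p.-tuple 'I_n) : bool :=
  incr_idx JK.1 && incr_idx JK.2.

Lemma LamNormE x : LamNorm g p x = l2 incr_pair (fun JK => YIK g JK.1 JK.2 x).
Proof. by rewrite /LamNorm /l2 pair_big. Qed.

Lemma LamDiffE y x :
  LamDiff g p y x = l2 incr_pair (fun JK => YIK g JK.1 JK.2 y - YIK g JK.1 JK.2 x).
Proof. by rewrite /LamDiff /l2 pair_big. Qed.

Lemma LamNorm_ge0 x : 0 <= LamNorm g p x.
Proof. exact: sqrt_pos. Qed.

Lemma LamDiff_ge0 y x : 0 <= LamDiff g p y x.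
Proof. exact: sqrt_pos. Qed.

Lemma LamDiffxx x : LamDiff g p x x = 0.
Proof. by rewrite LamDiffE l2_eq0 // => JK _; ring. Qed.

Lemma LamDiffC x y : LamDiff g p x y = LamDiff g p y x.
Proof. by rewrite !LamDiffE -l2N; apply: eq_l2 => JK _; ring. Qed.

Lemma LamDiff_triangle x y z : LamDiff g p x z <= LamDiff g p x y + LamDiff g p y z.
Proof.
rewrite !LamDiffE; apply: Rle_trans (l2_triangle _ _ _); apply: Req_le.
by apply: eq_l2 => JK _; ring.
Qed.

Lemma LamNorm_le_LamDiff x y : LamNorm g p y <= LamDiff g p y x + LamNorm g p x.
Proof.
rewrite LamDiffE !LamNormE; apply: Rle_trans (l2_triangle _ _ _); apply: Req_le.
by apply: eq_l2 => JK _; ring.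
Qed.

Lemma YIDiff_le_LamDiff (I : p.-tuple 'I_q) y x : incr_idx I -> YIDiff g I y x <= LamDiff g p y x.
Proof.
move=> incI; apply: sqrt_le_1_alt.
apply: (@sumR_ge_term _ (@incr_idx p q) (fun J => \big[Rplus/0]_(K : p.-tuple 'I_n | incr_idx K)
  (YIK g J K y - YIK g J K x) ^ 2) I) => // J _.
by apply: sumR_ge0 => K _; exact: pow2_ge_0.
Qed.

End LambdaNorms.

(** * Minors *)

Section MinorExpansion.
Import GRing.Theory.
Local Open Scope ring_scope.
Variable R : comNzRingType.

Lemma expand_det_replaced_row p (A : 'M[R]_p) (a : 'I_p) (v : 'I_p -> R) :
  \sum_b v b * cofactor A a b = \det (\matrix_(i, j) if i == a then v j else A i j).
Proof.
rewrite (expand_det_row _ a); apply: eq_bigr => b _; rewrite mxE eqxx; congr (_ * (_ * \det _)).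
by apply/matrixP => i j; rewrite !mxE eq_sym (negbTE (neq_lift _ _)).
Qed.

Lemma mxtrace_adjM p (A N : 'M[R]_p) :
  \tr (\adj A *m N) = \sum_a \sum_b N a b * cofactor A a b.
Proof.
rewrite exchange_big; apply: eq_bigr => b _; rewrite mxE.
by apply: eq_bigr => a _; rewrite mxE mulrC.
Qed.

Lemma mxtrace_adj_mxsubMl m n p (f : 'I_p -> 'I_m) (h : 'I_p -> 'I_n) (G : 'M[R]_(m, n))
    (X : 'M[R]_m) :
  \tr (\adj (mxsub f h G) *m mxsub f h (X *m G)) =
  \sum_a \sum_l X (f a) l * \det (mxsub [eta f with a |-> l] h G).
Proof.
rewrite mxtrace_adjM; apply: eq_bigr => a _.
transitivity (\sum_l X (f a) l * \sum_b G l (h b) * cofactor (mxsub f h G) a b).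
  under eq_bigr => b _ do rewrite !mxE big_distrl /=.
  rewrite exchange_big; apply: eq_bigr => l _; rewrite big_distrr.
  by apply: eq_bigr => b _; rewrite /= mulrA.
apply: eq_bigr => l _; rewrite expand_det_replaced_row; congr (_ * \det _).
by apply/matrixP => i j; rewrite !mxE /=; case: ifP.
Qed.

Lemma mxtrace_adj_mxsubMr m n p (f : 'I_p -> 'I_m) (h : 'I_p -> 'I_n) (G : 'M[R]_(m, n))
    (Y : 'M[R]_n) :
  \tr (\adj (mxsub f h G) *m mxsub f h (G *m Y)) =
  \sum_b \sum_i Y i (h b) * \det (mxsub f [eta h with b |-> i] G).
Proof.
rewrite -mxtrace_tr trmx_mul mxtrace_mulC trmx_adj !trmx_mxsub trmx_mul mxtrace_adj_mxsubMl.
by apply: eq_bigr => b _; apply: eq_bigr => i _; rewrite mxE -trmx_mxsub det_tr.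
Qed.

Lemma mxsubD m n p (f : 'I_p -> 'I_m) (h : 'I_p -> 'I_n) (G H : 'M[R]_(m, n)) :
  mxsub f h (G + H) = mxsub f h G + mxsub f h H.
Proof. by apply/matrixP => i j; rewrite !mxE. Qed.

Lemma det_mxsub_perm m n p (f : 'I_p -> 'I_m) (h : 'I_p -> 'I_n) (s t : 'S_p) (G : 'M[R]_(m, n)) :
  \det (mxsub (f \o s) (h \o t) G) = (-1) ^+ s * (-1) ^+ t * \det (mxsub f h G).
Proof.
have -> : mxsub (f \o s) (h \o t) G = row_perm s (col_perm t (mxsub f h G)).
  by apply/matrixP => i j; rewrite !mxE.
by rewrite row_permE col_permE !det_mulmx !det_perm odd_permV [X in _ * X]mulrC mulrA.
Qed.

Lemma det_mxsub_eq0l m n p (f : 'I_p -> 'I_m) (h : 'I_p -> 'I_n) (G : 'M[R]_(m, n)) :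
  ~~ injectiveb f -> \det (mxsub f h G) = 0.
Proof.
move=> /injectivePn [i [j ij fij]]; apply: (determinant_alternate ij) => b.
by rewrite !mxE fij.
Qed.

Lemma det_mxsub_eq0r m n p (f : 'I_p -> 'I_m) (h : 'I_p -> 'I_n) (G : 'M[R]_(m, n)) :
  ~~ injectiveb h -> \det (mxsub f h G) = 0.
Proof. by rewrite -det_tr trmx_mxsub; exact: det_mxsub_eq0l. Qed.

End MinorExpansion.

Lemma injective_incr_idx p m (f : 'I_p -> 'I_m) : injective f ->
  exists (J : p.-tuple 'I_m) (s : 'S_p), incr_idx J /\ f =1 tnth J \o s.
Proof.
move=> f_inj; pose leI := fun a b : 'I_m => leq a b; pose t := [tuple f i | i < p].
have size_sort_t : size (sort leI t) == p by rewrite size_sort size_tuple.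
have [s tE] : exists s : 'S_p, t = [tuple tnth (Tuple size_sort_t) (s i) | i < p] :> seq _.
  by apply/tuple_permP; rewrite perm_sym perm_sort.
exists (Tuple size_sort_t), s; split=> [|i]; last first.
  by rewrite /= -(tnth_mktuple f) -/t (val_inj tE) tnth_mktuple.
rewrite /incr_idx /= (_ : sorted _ _ = sorted ltn (map val (sort leI t)));
  last by rewrite sorted_map.
rewrite ltn_sorted_uniq_leq map_inj_uniq ?sort_uniq; last exact: val_inj.
rewrite map_inj_uniq ?enum_uniq //= sorted_map.
by apply: sort_sorted => a b; exact: leq_total.
Qed.

Section FieldMatrix.
Variables (q n : nat) (g : 'I_q -> ('I_n -> R) -> ('I_n -> R)) (p : nat).

Definition fields_mx (x : 'I_n -> R) : 'M[R]_(n, q) := (\matrix_(a, k) g k x a)%R.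

Definition minor_mx (J : p.-tuple 'I_q) (K : p.-tuple 'I_n) (x : 'I_n -> R) : 'M[R]_p :=
  mxsub (tnth K) (tnth J) (fields_mx x).

Lemma YIKE J K x : YIK g J K x = (\det (minor_mx J K x))%R.
Proof.
apply: eq_bigr => s _; rewrite -RmultE; congr (_ * _).
  by case: (odd_perm s).
by apply: eq_bigr => a _; rewrite !mxE.
Qed.

Lemma Rabs_minor_le_LamNorm (f : 'I_p -> 'I_n) (h : 'I_p -> 'I_q) x :
  Rabs (\det (mxsub f h (fields_mx x)))%R <= LamNorm g p x.
Proof.
have [f_inj|/det_mxsub_eq0l ->] := boolP (injectiveb f); last first.
  by rewrite Rabs_R0; exact: LamNorm_ge0.
have [h_inj|/det_mxsub_eq0r ->] := boolP (injectiveb h); last first.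
  by rewrite Rabs_R0; exact: LamNorm_ge0.
have [K [s [incK fE]]] := injective_incr_idx (injectiveP _ f_inj).
have [J [t [incJ hE]]] := injective_incr_idx (injectiveP _ h_inj).
have -> : mxsub f h (fields_mx x) = mxsub (tnth K \o s) (tnth J \o t) (fields_mx x).
  exact: eq_mxsub.
rewrite det_mxsub_perm -/(minor_mx J K x) -YIKE LamNormE.
have := Rabs_le_l2 (P := @incr_pair q n p) (fun JK => YIK g JK.1 JK.2 x) (i := (J, K)).
rewrite /incr_pair incJ => /(_ incK); apply: Rle_trans; apply: Req_le.
by rewrite !RabsE !Num.Theory.normrM !Num.Theory.normr_sign !GRing.mul1r.
Qed.

End FieldMatrix.

(** * Derivatives *)

Lemma filter_finite_forall (T : Type) (F : (T -> Prop) -> Prop) {FF : Filter F} (I : finType)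
    (P : I -> T -> Prop) :
  (forall i, F (P i)) -> F (fun x => forall i, P i x).
Proof.
move=> FP; suff : F (fun x => forall i, i \in enum I -> P i x).
  by apply: filter_imp => x Px i; apply: Px; rewrite mem_enum.
elim: (enum I) => [|i r IH]; first by apply: filter_imp filter_true.
apply: filter_imp (filter_and _ _ (FP i) IH) => x [Pi Pr] j.
by rewrite in_cons => /orP [/eqP -> //|]; exact: Pr.
Qed.

Lemma locally_ball (x eps : R) : 0 < eps -> locally x (fun y => Rabs (y - x) < eps).
Proof. by move=> eps0; exists (mkposreal eps eps0). Qed.

Lemma locally_ball_ex (x : R) (P : R -> Prop) :
  locally x P -> exists d, 0 < d /\ forall y, Rabs (y - x) < d -> P y.
Proof. by move=> [d Pd]; exists d; split=> [|y]; [exact: cond_pos | exact: Pd]. Qed.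

Lemma is_derive_remainderP (f : R -> R) (t l : R) :
  is_derive f t l <->
  forall eps, 0 < eps ->
    locally t (fun s => Rabs (f s - f t - l * (s - t)) <= eps * Rabs (s - t)).
Proof.
have domE s : minus (minus (f s) (f t)) (scal (minus s t) l) = f s - f t - l * (s - t).
  by rewrite /minus /plus /opp /scal /= /mult /=; ring.
split=> [[_ dom] eps eps0|rem].
  apply: filter_imp (dom t (fun P Pt => Pt) (mkposreal eps eps0)) => s.
  by rewrite domE.
split; first exact: is_linear_scal_l.
move=> x /(is_filter_lim_locally_unique t x) <- eps.
by apply: filter_imp (rem eps (cond_pos eps)) => s; rewrite domE.
Qed.

Lemma is_derive_Rabs_le (f : R -> R) (t l L : R) : is_derive f t l ->
  locally t (fun s => Rabs (f s - f t) <= L * Rabs (s - t)) -> Rabs l <= L.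
Proof.
move=> /is_derive_remainderP rem lip; apply: Rle_plus_epsilon => eps eps0.
have [d [d0 near_t]] := locally_ball_ex (filter_and _ _ (rem eps eps0) lip).
have st : t + d / 2 - t = d / 2 by ring.
have [|rem_s lip_s] := near_t (t + d / 2); first by rewrite st Rabs_pos_eq; lra.
rewrite st (Rabs_pos_eq (d / 2)) in rem_s lip_s; last lra.
apply: (Rmult_le_reg_r (d / 2)); first lra.
rewrite -{1}(Rabs_pos_eq (d / 2)) -?Rabs_mult; last lra.
set fs := f _ - f t in rem_s lip_s *.
have := Rabs_triang fs (- (fs - l * (d / 2))); rewrite Rabs_Ropp.
by rewrite (_ : fs + - (fs - l * (d / 2)) = l * (d / 2)); [lra | ring].
Qed.

Lemma l2_increment_le (I : finType) (P : pred I) (c : R -> I -> R) (c' : I -> R) (t V : R) :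
  (forall i, is_derive (fun s => c s i) t (c' i)) -> l2 P c' < V ->
  locally t (fun s => l2 P (fun i => c s i - c t i) <= V * Rabs (s - t)).
Proof.
move=> dc c'V; pose N := INR #|I| + 1; have N1 : 1 <= N by have := pos_INR #|I|; rewrite /N; lra.
have eps0 : 0 < (V - l2 P c') / N by apply: Rdiv_lt_0_compat; lra.
have rem_small i := proj1 (is_derive_remainderP _ _ _) (dc i) _ eps0.
apply: filter_imp (filter_finite_forall rem_small) => s rem; have s0 := Rabs_pos (s - t).
rewrite (@eq_l2 _ P _ (fun i => (c s i - c t i - c' i * (s - t)) + (s - t) * c' i)); last first.
  by move=> i _; ring.
apply: Rle_trans (l2_triangle _ _ _) _; rewrite l2Z.
have := @l2_le_card _ P _ _ (Rmult_le_pos _ _ (Rlt_le _ _ eps0) s0) (fun i _ => rem i).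
have : N * ((V - l2 P c') / N * Rabs (s - t)) = (V - l2 P c') * Rabs (s - t) by field; lra.
by have := Rmult_le_pos _ _ (Rlt_le _ _ eps0) s0; rewrite /N; lra.
Qed.

Lemma is_derive_sumR (I : Type) (r : seq I) (P : pred I) (f : I -> R -> R) (df : I -> R) (t : R) :
  (forall i, P i -> is_derive (f i) t (df i)) ->
  is_derive (fun s => \big[Rplus/0]_(i <- r | P i) f i s) t (\big[Rplus/0]_(i <- r | P i) df i).
Proof.
move=> dF; elim: r => [|i r IH].
  rewrite big_nil; apply: (is_derive_ext (fun _ => 0)) => [s|]; first by rewrite big_nil.
  exact: is_derive_const.
rewrite big_cons; case: ifP => Pi.
  apply: (is_derive_ext (fun s => f i s + \big[Rplus/0]_(i <- r | P i) f i s)) => [s|].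
    by rewrite big_cons Pi.
  by apply: is_derive_plus => //; exact: dF.
by apply: is_derive_ext IH => s; rewrite big_cons Pi.
Qed.

Lemma is_derive_prodR (I : eqType) (r : seq I) (f : I -> R -> R) (df : I -> R) (t : R) :
  uniq r -> (forall i, is_derive (f i) t (df i)) ->
  is_derive (fun s => \big[Rmult/1]_(i <- r) f i s) t
    (\big[Rplus/0]_(i <- r) \big[Rmult/1]_(j <- r) (if j == i then df j else f j t)).
Proof.
move=> + dF; elim: r => [_|i r IH /andP[ir ur]].
  rewrite big_nil; apply: (is_derive_ext (fun _ => 1)) => [s|]; first by rewrite big_nil.
  exact: is_derive_const.
apply: (is_derive_ext (fun s => f i s * \big[Rmult/1]_(i <- r) f i s)) => [s|].
  by rewrite big_cons.
have -> : \big[Rplus/0]_(k <- i :: r) \big[Rmult/1]_(j <- i :: r) (if j == k then df j else f j t) =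
    df i * \big[Rmult/1]_(j <- r) f j t +
    f i t * \big[Rplus/0]_(k <- r) \big[Rmult/1]_(j <- r) (if j == k then df j else f j t).
  rewrite !big_cons eqxx big_distrr; congr (_ * _ + _).
    by apply: eq_big_seq => j jr; case: eqP jr ir => // -> ->.
  by apply: eq_big_seq => k kr; rewrite big_cons; case: eqP kr ir => // -> ->.
by apply: is_derive_mult => //; [exact: IH | exact: Rmult_comm].
Qed.

Lemma is_derive_det p (A : R -> 'M[R]_p) (dA : 'M[R]_p) (t : R) :
  (forall a b, is_derive (fun s => A s a b) t (dA a b)) ->
  is_derive (fun s => \det (A s))%R t (\tr (\adj (A t) *m dA))%R.
Proof.
move=> dAab; rewrite mxtrace_adjM.
under eq_bigr => a _ do rewrite expand_det_replaced_row.
rewrite exchange_big /=; apply: is_derive_sumR => s _.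
rewrite -GRing.mulr_sumr; apply: is_derive_scal.
rewrite (eq_bigr (fun a => \big[Rmult/1]_i (if i == a then dA i (s i) else A t i (s i))));
  last by move=> a _; apply: eq_bigr => i _; rewrite mxE; case: eqP => // ->.
apply: (@is_derive_prodR _ _ (fun a z => A z a (s a)) (fun a => dA a (s a))) => //.
exact: index_enum_uniq.
Qed.

Section Frechet.
Variables (n : nat) (f : ('I_n -> R) -> ('I_n -> R)).

Lemma is_derive_frechet_comp (D : 'I_n -> 'I_n -> R) (gam : R -> 'I_n -> R) (t : R) (v : 'I_n -> R)
    (a : 'I_n) :
  frechet f (gam t) D -> (forall b, is_derive (fun s => gam s b) t (v b)) ->
  is_derive (fun s => f (gam s) a) t (\big[Rplus/0]_(b < n) (D a b * v b)).
Proof.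
move=> fD dgam; pose lin s := \big[Rplus/0]_(b < n) (D a b * (gam s b - gam t b)).
have dlin : is_derive lin t (\big[Rplus/0]_(b < n) (D a b * v b)).
  apply: is_derive_sumR => b _; apply: is_derive_scal; rewrite -[v b]Rminus_0_r.
  by apply: is_derive_minus => //; exact: is_derive_const.
suff drem : is_derive (fun s => f (gam s) a - lin s) t 0.
  rewrite -[X in is_derive _ _ X]Rplus_0_l.
  by apply: is_derive_ext (is_derive_plus _ _ _ _ _ drem dlin) => s; rewrite /plus /=; ring.
apply/is_derive_remainderP => eps eps_gt0.
pose W := norm2 v + 1; have W_gt0 : 0 < W by have := norm2_ge0 v; rewrite /W; lra.
have [delta [delta_gt0 fdelta]] := fD (eps / W) (Rdiv_lt_0_compat _ _ eps_gt0 W_gt0).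
have vW : norm2 v < W by rewrite /W; lra.
apply: filter_imp (filter_and _ _ (l2_increment_le dgam vW)
  (locally_ball t (Rdiv_lt_0_compat _ _ delta_gt0 W_gt0))) => s [inc st].
have sW : W * Rabs (s - t) < delta.
  by rewrite (_ : delta = W * (delta / W)); [exact: Rmult_lt_compat_l | field; lra].
have := fdelta (gam s) (Rle_lt_trans _ _ _ inc sW).
set rem := (fun a => _); have := Rabs_le_norm2 rem a; rewrite {1}/rem => rem_a rem_n.
rewrite (_ : f (gam s) a - lin s - _ - _ = f (gam s) a - f (gam t) a - lin s); last first.
  by rewrite /lin [X in _ - (_ - X)]big1 => [|b _]; ring.
apply: Rle_trans rem_a _; apply: Rle_trans rem_n _.
rewrite (_ : eps * Rabs (s - t) = eps / W * (W * Rabs (s - t))); last by field; lra.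
by apply: Rmult_le_compat_l => //; apply: Rlt_le; exact: Rdiv_lt_0_compat.
Qed.

Lemma line_at_0 (x v : 'I_n -> R) : (fun b => x b + 0 * v b) = x.
Proof. by apply: functional_extensionality => b; ring. Qed.

Lemma is_derive_frechet_line (D : 'I_n -> 'I_n -> R) (x v : 'I_n -> R) (a : 'I_n) :
  frechet f x D ->
  is_derive (fun s => f (fun b => x b + s * v b) a) 0 (\big[Rplus/0]_(b < n) (D a b * v b)).
Proof.
rewrite -{1}(line_at_0 x v) => fD.
apply: (is_derive_frechet_comp (gam := fun s b => x b + s * v b)) => // b.
by auto_derive => //; ring.
Qed.

Lemma frechet_unique (D D' : 'I_n -> 'I_n -> R) (x v : 'I_n -> R) (a : 'I_n) :
  frechet f x D -> frechet f x D' ->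
  \big[Rplus/0]_(b < n) (D a b * v b) = \big[Rplus/0]_(b < n) (D' a b * v b).
Proof.
move=> /(is_derive_frechet_line v a)/is_derive_unique <-.
by move=> /(is_derive_frechet_line v a)/is_derive_unique <-.
Qed.

Lemma frechet_coef_le (D : 'I_n -> 'I_n -> R) (x : 'I_n -> R) (a b : 'I_n) (r L : R) :
  frechet f x D -> 0 < r ->
  (forall y, norm2 (vsub y x) < r -> Rabs (f y a - f x a) <= L * norm2 (vsub y x)) ->
  Rabs (D a b) <= L.
Proof.
move=> fD r0 lip; pose e := [fun i : 'I_n => 0 with b |-> 1].
have -> : D a b = \big[Rplus/0]_(i < n) (D a i * e i).
  by rewrite (bigD1 b) //= eqxx big1 => [|i /negbTE /= ->]; ring.
apply: is_derive_Rabs_le (is_derive_frechet_line e a fD) _.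
have normE s : norm2 (vsub (fun i => x i + s * e i) x) = Rabs s.
  rewrite -(sqrt_Rsqr_abs s) Rsqr_pow2; congr sqrt.
  rewrite (bigD1 b) //= big1 => [|i /negbTE ib].
    by rewrite /vsub /= eqxx; ring.
  by rewrite /vsub /= ib; ring.
apply: filter_imp (locally_ball 0 r0) => s; rewrite line_at_0 Rminus_0_r => sr.
by rewrite -(normE s); apply: lip; rewrite normE.
Qed.

End Frechet.

(** * Lipschitz functions on bounded sets *)

Section LipBounded.
Variables (n : nat) (B : ('I_n -> R) -> Prop).
Implicit Types (f h : ('I_n -> R) -> R) (L : R).

Definition lip_bounded L f : Prop :=
  (forall x, B x -> Rabs (f x) <= L) /\
  (forall x y, B x -> B y -> Rabs (f x - f y) <= L * norm2 (vsub x y)).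

Definition ex_lip_bounded f : Prop := exists L, lip_bounded L f.

Lemma lip_bounded_le L L' f : L <= L' -> lip_bounded L f -> lip_bounded L' f.
Proof.
move=> LL' [bf lf]; split=> [x Bx|x y Bx By]; first by have := bf x Bx; lra.
by apply: Rle_trans (lf x y Bx By) _; apply: Rmult_le_compat_r => //; exact: norm2_ge0.
Qed.

Lemma lip_bounded_ext L f h : (forall x, f x = h x) -> lip_bounded L f -> lip_bounded L h.
Proof. by move=> fh [bf lf]; split=> *; rewrite -!fh; auto. Qed.

Lemma ex_lip_bounded_ext f h : (forall x, f x = h x) -> ex_lip_bounded f -> ex_lip_bounded h.
Proof. by move=> fh [L lf]; exists L; exact: lip_bounded_ext lf. Qed.

Lemma ex_lip_bounded_const (c : R) : ex_lip_bounded (fun=> c).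
Proof.
exists (Rabs c); split=> [x _|x y _ _]; first exact: Rle_refl.
by rewrite Rminus_diag Rabs_R0; apply: Rmult_le_pos; [exact: Rabs_pos | exact: norm2_ge0].
Qed.

Lemma ex_lip_boundedD f h :
  ex_lip_bounded f -> ex_lip_bounded h -> ex_lip_bounded (fun x => f x + h x).
Proof.
move=> [L [bf lf]] [L' [bh lh]]; exists (L + L'); split=> [x Bx|x y Bx By].
  by have := bf x Bx; have := bh x Bx; have := Rabs_triang (f x) (h x); lra.
have := lf x y Bx By; have := lh x y Bx By; have := Rabs_triang (f x - f y) (h x - h y).
by rewrite (_ : f x - f y + (h x - h y) = f x + h x - (f y + h y)); [lra | ring].
Qed.

Lemma ex_lip_boundedM f h :
  ex_lip_bounded f -> ex_lip_bounded h -> ex_lip_bounded (fun x => f x * h x).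
Proof.
move=> [L [bf lf]] [L' [bh lh]]; exists (2 * (L * L')).
split=> [x Bx|x y Bx By].
  have := Rabs_mult_le (bf x Bx) (bh x Bx); have := Rabs_pos (f x * h x); lra.
have := Rabs_triang (f x * (h x - h y)) ((f x - f y) * h y).
rewrite (_ : f x * (h x - h y) + _ = f x * h x - f y * h y); last by ring.
have := Rabs_mult_le (bf x Bx) (lh x y Bx By); have := Rabs_mult_le (lf x y Bx By) (bh y By).
by lra.
Qed.

Lemma ex_lip_bounded_sumR (I : Type) (r : seq I) (F : I -> ('I_n -> R) -> R) :
  (forall i, ex_lip_bounded (F i)) -> ex_lip_bounded (fun x => \big[Rplus/0]_(i <- r) F i x).
Proof.
move=> lF; elim: r => [|i r IH].
  by apply: ex_lip_bounded_ext (ex_lip_bounded_const 0) => x; rewrite big_nil.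
by apply: ex_lip_bounded_ext (ex_lip_boundedD (lF i) IH) => x; rewrite big_cons.
Qed.

Lemma ex_lip_bounded_prodR (I : Type) (r : seq I) (F : I -> ('I_n -> R) -> R) :
  (forall i, ex_lip_bounded (F i)) -> ex_lip_bounded (fun x => \big[Rmult/1]_(i <- r) F i x).
Proof.
move=> lF; elim: r => [|i r IH].
  by apply: ex_lip_bounded_ext (ex_lip_bounded_const 1) => x; rewrite big_nil.
by apply: ex_lip_bounded_ext (ex_lip_boundedM (lF i) IH) => x; rewrite big_cons.
Qed.

Lemma ex_lip_bounded_det p (A : ('I_n -> R) -> 'M[R]_p) :
  (forall i j, ex_lip_bounded (fun x => A x i j)) -> ex_lip_bounded (fun x => \det (A x))%R.
Proof.
move=> lA; apply: ex_lip_bounded_sumR => s; apply: ex_lip_boundedM.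
  exact: ex_lip_bounded_const.
by apply: ex_lip_bounded_prodR => i; exact: lA.
Qed.

Lemma ex_lip_bounded_cofactor p (A : ('I_n -> R) -> 'M[R]_p) (i j : 'I_p) :
  (forall i j, ex_lip_bounded (fun x => A x i j)) -> ex_lip_bounded (fun x => cofactor (A x) i j).
Proof.
move=> lA; apply: ex_lip_boundedM; first exact: ex_lip_bounded_const.
by apply: ex_lip_bounded_det => k l; apply: ex_lip_bounded_ext (lA (lift i k) (lift j l)) => x;
  rewrite !mxE.
Qed.

End LipBounded.

Lemma bounded_n_mk_Tn n (M : R) (u : nat -> R) : (forall k, Rabs (u k) <= M) ->
  bounded_n n (mk_Tn n (fun=> - M)) (mk_Tn n (fun=> M)) (mk_Tn n u).
Proof.
by elim: n u => //= n IH u uM; split; [apply/Rabs_le_between; exact: uM | apply: IH].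
Qed.

Lemma close_n_coeff_Tn n (d : R) (v w : Compactness.Tn n R) (k : nat) : (k < n)%nat ->
  close_n n d v w -> Rabs (coeff_Tn 0 v k - coeff_Tn 0 w k) < d.
Proof. by elim: n v w k => // n IH [v1 v2] [w1 w2] [|k] //= kn [] // _; exact: IH. Qed.

Lemma compact_gauge n (M : R) (delta : ('I_n -> R) -> R) : 0 <= M -> (forall t, 0 < delta t) ->
  exists d, 0 < d /\ forall x, (forall i, Rabs (x i) <= M) ->
    exists t, (forall i, Rabs (x i - t i) < delta t) /\ d <= delta t.
Proof.
move=> M_ge0 delta0; pose dec (v : Compactness.Tn n R) (i : 'I_n) := coeff_Tn 0 v i.
have [d cover] := compactness_value n (mk_Tn n (fun=> - M)) (mk_Tn n (fun=> M))
  (fun v => mkposreal _ (delta0 (dec v))).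
exists d; split=> [|x xM]; first exact: cond_pos.
pose u k := oapp x 0 (insub k).
have uM k : Rabs (u k) <= M by rewrite /u; case: insub => //=; rewrite Rabs_R0.
have [t [_ [tx dt]]] := NNPP _ (cover _ (bounded_n_mk_Tn n uM)).
exists (dec t); split=> // i; have := close_n_coeff_Tn (ltn_ord i) tx.
by rewrite coeff_Tn_bij; [rewrite /u valK | apply/ltP].
Qed.

Lemma loc_lip_scale n (f : ('I_n -> R) -> ('I_n -> R)) (M : R) :
  loc_lip f -> 0 <= M ->
  exists d, 0 < d /\ forall x, (forall i, Rabs (x i) <= M) ->
    norm2 (f x) <= / d /\
    forall y, norm2 (vsub x y) < d -> norm2 (vsub (f x) (f y)) <= / d * norm2 (vsub x y).
Proof.
move=> lipf M_ge0; have n0 := pos_INR n.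
have [r lip_r] := functional_choice _ lipf; have [L lip] := functional_choice _ lip_r.
pose S t := 1 + 2 * (INR n + 1) / r t + Rabs (L t) * (1 + r t) + norm2 (f t).
have r0 t : 0 < r t by case: (lip t).
have nr t : 0 < 2 * (INR n + 1) / r t by apply: Rdiv_lt_0_compat => //; lra.
have Lr t : 0 <= Rabs (L t) * r t by apply: Rmult_le_pos; [exact: Rabs_pos | apply: Rlt_le].
have S0 t : 0 < S t.
  by have := nr t; have := Lr t; have := Rabs_pos (L t); have := norm2_ge0 (f t); rewrite /S; lra.
have [|d [d0 gauge]] := @compact_gauge n M (fun t => / S t) M_ge0.
  by move=> t; exact: Rinv_0_lt_compat.
exists d; split=> // x /gauge [t [xt dt]].
have Sd : S t <= / d by rewrite -(Rinv_inv (S t)); exact: Rinv_le_contravar.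
have Lt := Rle_abs (L t); have Lt0 := Rabs_pos (L t); have ft0 := norm2_ge0 (f t).
have Sr : 2 * (INR n + 1) * / S t <= r t.
  apply: (Rmult_le_reg_r (S t)) => //.
  rewrite (_ : _ * / S t * S t = r t * (2 * (INR n + 1) / r t)).
    by apply: Rmult_le_compat_l; [apply: Rlt_le | have := Lr t; rewrite /S; lra].
  by field; split; apply: Rgt_not_eq.
have dr : d <= r t / 2 by have := Rmult_le_pos _ _ n0 (Rlt_le _ _ d0); nra.
have xr2 : norm2 (vsub x t) < r t / 2.
  have := @norm2_le_dim _ (vsub x t) (/ S t) _ (fun i => Rlt_le _ _ (xt i)).
  by have := Rinv_0_lt_compat _ (S0 t); nra.
have xr : norm2 (vsub x t) < r t by have := r0 t; lra.
split=> [|y xy].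
  have tr : norm2 (vsub t t) < r t by rewrite norm2_vsubxx.
  have := proj2 (lip t) x t xr tr; have := norm2_vsub_le (f x) (f t).
  have := Rmult_le_compat _ _ _ _ Lt0 (norm2_ge0 (vsub x t)) (Rle_refl _) (Rlt_le _ _ xr).
  have := Rmult_le_compat_r _ _ _ (norm2_ge0 (vsub x t)) Lt.
  by have := nr t; move: Sd; rewrite /S; lra.
have yr : norm2 (vsub y t) < r t.
  by have := norm2_triangle y x t; rewrite (norm2_vsubC y x); lra.
apply: Rle_trans (proj2 (lip t) x y xr yr) _; apply: Rmult_le_compat_r; first exact: norm2_ge0.
by have := nr t; have := Lr t; move: Sd; rewrite /S; lra.
Qed.

Lemma loc_lip_ex_lip_bounded n (f : ('I_n -> R) -> ('I_n -> R)) (B : ('I_n -> R) -> Prop)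
    (a : 'I_n) :
  loc_lip f -> is_bounded B -> ex_lip_bounded B (fun x => f x a).
Proof.
move=> lipf [M BM]; have [d [d0 scale]] := loc_lip_scale lipf (Rabs_pos M).
have id0 := Rinv_0_lt_compat _ d0.
have cube x i : B x -> Rabs (x i) <= Rabs M.
  by move=> /BM xM; have := Rabs_le_norm2 x i; have := Rle_abs M; lra.
have fd x : B x -> Rabs (f x a) <= / d.
  by move=> Bx; apply: Rle_trans (Rabs_le_norm2 _ a) _; case: (scale x) => // i; exact: cube.
have idd : 0 < / d * / d by exact: Rmult_lt_0_compat.
exists (/ d + 2 * (/ d * / d)); split=> [x /fd|x y Bx By]; first lra.
have xy0 := norm2_ge0 (vsub x y).
have [near|far] := Rlt_le_dec (norm2 (vsub x y)) d.
  have := Rabs_le_norm2 (vsub (f x) (f y)) a.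
  have := proj2 (scale x (fun i => cube x i Bx)) y near; rewrite {3}/vsub.
  by nra.
have := Rabs_triang (f x a) (- f y a); rewrite Rabs_Ropp.
have := fd x Bx; have := fd y By.
have : / d * / d * d = / d by field; lra.
by rewrite /Rminus; nra.
Qed.

(** * The derivative of the minors under condition (H) *)

Definition open_ball n (r : R) (x : 'I_n -> R) : Prop := norm2 x < r.

Lemma is_bounded_open_ball n r : is_bounded (@open_ball n r).
Proof. by exists r => x; exact: Rlt_le. Qed.

Lemma is_open_open_ball n r : is_open (@open_ball n r).
Proof.
move=> x xr; exists (r - norm2 x); split=> [|y yx]; first by rewrite /open_ball in xr; lra.
by have := norm2_vsub_le y x; rewrite /open_ball; lra.
Qed.

Section Involutive.
Variables (q n : nat) (g : 'I_q -> ('I_n -> R) -> ('I_n -> R)).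

Definition brackets_spanned (C : R) (x : 'I_n -> R) : Prop :=
  forall j k : 'I_q, exists Dj Dk, frechet (g j) x Dj /\ frechet (g k) x Dk /\
    exists c : 'I_q -> R, norm2 c <= C /\ forall a : 'I_n,
      \big[Rplus/0]_(b < n) (Dk a b * g j x b - Dj a b * g k x b) =
      \big[Rplus/0]_(i < q) (c i * g i x a).

Lemma brackets_spanned_le C C' x : C <= C' -> brackets_spanned C x -> brackets_spanned C' x.
Proof.
move=> CC' span j k; have [Dj [Dk [Dj_frechet [Dk_frechet [c [cC bracketE]]]]]] := span j k.
by exists Dj, Dk; do !split=> //; exists c; split=> //; exact: Rle_trans CC'.
Qed.

(* The derivatives in [brackets_spanned] may depend on the pair [j, k]; here they do not. *)
Lemma brackets_spanned_jacobians C x : brackets_spanned C x ->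
  exists (D : 'I_q -> 'I_n -> 'I_n -> R) (c : 'I_q -> 'I_q -> 'I_q -> R),
    (forall j, frechet (g j) x (D j)) /\
    (forall j k i, Rabs (c j k i) <= C) /\
    forall j k a,
      \big[Rplus/0]_(b < n) (D k a b * g j x b) =
      \big[Rplus/0]_(b < n) (D j a b * g k x b) + \big[Rplus/0]_(i < q) (c j k i * g i x a).
Proof.
move=> span.
have /functional_choice [D D_frechet] : forall j, exists D, frechet (g j) x D.
  by move=> j; have [Dj [_ [Dj_frechet _]]] := span j j; exists Dj.
have /functional_choice [c c_bracket] : forall jk : 'I_q * 'I_q, exists c : 'I_q -> R,
    norm2 c <= C /\ forall a, \big[Rplus/0]_(b < n) (D jk.2 a b * g jk.1 x b) =
      \big[Rplus/0]_(b < n) (D jk.1 a b * g jk.2 x b) + \big[Rplus/0]_(i < q) (c i * g i x a).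
  move=> [j k] /=; have [Dj [Dk [Dj_frechet [Dk_frechet [c [cC bracketE]]]]]] := span j k.
  exists c; split=> // a; rewrite -bracketE sumRB.
  rewrite (frechet_unique _ a (D_frechet k) Dk_frechet).
  by rewrite (frechet_unique _ a (D_frechet j) Dj_frechet) Rplus_minus.
exists D, (fun j k => c (j, k)); split=> //; split=> [j k i|j k a].
  by apply: Rle_trans (Rabs_le_norm2 _ i) _; case: (c_bracket (j, k)).
exact: (proj2 (c_bracket (j, k))).
Qed.

Definition fields_velocity (D : 'I_q -> 'I_n -> 'I_n -> R) (v : 'I_n -> R) : 'M[R]_(n, q) :=
  (\matrix_(a, k) \big[Rplus/0]_(b < n) (D k a b * v b))%R.

Lemma fields_velocityD D v w :
  fields_velocity D (fun b => v b + w b) = (fields_velocity D v + fields_velocity D w)%R.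
Proof.
apply/matrixP => a k; rewrite !mxE -RplusE -big_split /=.
by apply: eq_bigr => b _; exact: Rmult_plus_distr_l.
Qed.

(* Along a combination of the fields, [D_k] applied to [g_j] is traded for [D_j] applied to [g_k],
   which multiplies the matrix of the fields on the left, plus a combination of the fields,
   which multiplies it on the right. *)
Lemma involutive_velocity (L C : R) (x : 'I_n -> R) (u : 'I_q -> R)
    (D : 'I_q -> 'I_n -> 'I_n -> R) (c : 'I_q -> 'I_q -> 'I_q -> R) :
  (forall j, Rabs (u j) <= 1) -> 0 <= L -> (forall j a b, Rabs (D j a b) <= L) ->
  0 <= C -> (forall j k i, Rabs (c j k i) <= C) ->
  (forall j k a,
      \big[Rplus/0]_(b < n) (D k a b * g j x b) =
      \big[Rplus/0]_(b < n) (D j a b * g k x b) + \big[Rplus/0]_(i < q) (c j k i * g i x a)) ->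
  exists (X : 'M[R]_n) (Y : 'M[R]_q),
    (forall a b, Rabs (X a b) <= INR q * L) /\ (forall i k, Rabs (Y i k) <= INR q * C) /\
    (fields_velocity D (fun b => \big[Rplus/0]_(j < q) (u j * g j x b)) =
     X *m fields_mx g x + fields_mx g x *m Y)%R.
Proof.
move=> u_le1 L_ge0 DL C_ge0 cC bracketE.
have combination_le (v : 'I_q -> R) M : 0 <= M -> (forall j, Rabs (v j) <= M) ->
    Rabs (\big[Rplus/0]_(j < q) (u j * v j)) <= INR q * M.
  by move=> M_ge0 vM; apply: Rabs_sumR_le_ord => // j; rewrite -(Rmult_1_l M); apply: Rabs_mult_le.
exists (\matrix_(a, b) \big[Rplus/0]_(j < q) (u j * D j a b))%R,
  (\matrix_(i, k) \big[Rplus/0]_(j < q) (u j * c j k i))%R.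
split=> [a b|]; first by rewrite mxE; exact: combination_le.
split=> [i k|]; first by rewrite mxE; exact: combination_le.
apply/matrixP => a k; rewrite !mxE -RplusE.
transitivity (\big[Rplus/0]_(j < q) (u j * \big[Rplus/0]_(b < n) (D k a b * g j x b))).
  under eq_bigr => b _ do rewrite big_distrr /=.
  rewrite exchange_big; apply: eq_bigr => j _; rewrite big_distrr /=.
  by apply: eq_bigr => b _; exact: GRing.mulrCA.
under eq_bigr => j _ do rewrite bracketE Rmult_plus_distr_l !big_distrr /=.
rewrite big_split /=; congr (_ + _); rewrite exchange_big; apply: eq_bigr => b _.
  by rewrite !mxE big_distrl; apply: eq_bigr => j _; exact: GRing.mulrA.
by rewrite !mxE big_distrr; apply: eq_bigr => j _; rewrite -Rmult_assoc Rmult_comm.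
Qed.

Lemma LamDiff_lipschitz p (B : ('I_n -> R) -> Prop) :
  (forall j a, ex_lip_bounded B (fun x => g j x a)) ->
  exists L, 0 <= L /\ forall x y, B x -> B y -> LamDiff g p y x <= L * norm2 (vsub y x).
Proof.
move=> lip_g; pose T := (p.-tuple 'I_q * p.-tuple 'I_n)%type.
have [||L [L_ge0 lipL]] := @exists_common_bound T
    (fun JK L => lip_bounded B L (fun x => YIK g JK.1 JK.2 x)).
- by move=> JK L L'; exact: lip_bounded_le.
- move=> JK; apply: ex_lip_bounded_ext (fun x => esym (YIKE g JK.1 JK.2 x)) _.
  apply: ex_lip_bounded_det => a b.
  by apply: ex_lip_bounded_ext (lip_g (tnth JK.1 b) (tnth JK.2 a)) => x; rewrite !mxE.
exists (INR #|{: T}| * L); split=> [|x y Bx By].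
  by apply: Rmult_le_pos => //; exact: pos_INR.
rewrite LamDiffE Rmult_assoc; apply: l2_le_card => [|JK _].
  by apply: Rmult_le_pos => //; exact: norm2_ge0.
exact: (proj2 (lipL JK)).
Qed.

Section MinorBounds.
Variables (p : nat) (f : 'I_p -> 'I_n) (h : 'I_p -> 'I_q) (x : 'I_n -> R).
Let A := mxsub f h (fields_mx g x).

Lemma mxtrace_adj_involutive_le (X : 'M[R]_n) (Y : 'M[R]_q) (cX cY : R) :
  0 <= cX -> (forall a b, Rabs (X a b) <= cX) -> 0 <= cY -> (forall i k, Rabs (Y i k) <= cY) ->
  Rabs (\tr (\adj A *m mxsub f h (X *m fields_mx g x + fields_mx g x *m Y)))%R <=
  INR p * (INR n * (cX * LamNorm g p x)) + INR p * (INR q * (cY * LamNorm g p x)).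
Proof.
move=> cX_ge0 Xc cY_ge0 Yc; have Lam_ge0 := LamNorm_ge0 g p x.
rewrite mxsubD mulmxDr mxtraceD mxtrace_adj_mxsubMl mxtrace_adj_mxsubMr.
have cXLam := Rmult_le_pos _ _ cX_ge0 Lam_ge0; have cYLam := Rmult_le_pos _ _ cY_ge0 Lam_ge0.
apply: Rle_trans (Rabs_triang _ _) _; apply: Rplus_le_compat.
  apply: Rabs_sumR_le_ord => [|a]; first by apply: Rmult_le_pos => //; exact: pos_INR.
  by apply: Rabs_sumR_le_ord => // l; apply: Rabs_mult_le => //; exact: Rabs_minor_le_LamNorm.
apply: Rabs_sumR_le_ord => [|b]; first by apply: Rmult_le_pos => //; exact: pos_INR.
by apply: Rabs_sumR_le_ord => // i; apply: Rabs_mult_le => //; exact: Rabs_minor_le_LamNorm.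
Qed.

Lemma mxtrace_adj_error_le (E : 'M[R]_(n, q)) (e M : R) :
  0 <= e -> (forall a k, Rabs (E a k) <= e) -> 0 <= M -> (forall a b, Rabs (cofactor A a b) <= M) ->
  Rabs (\tr (\adj A *m mxsub f h E))%R <= INR p * (INR p * (e * M)).
Proof.
move=> e0 Ee M_ge0 AM; have eM := Rmult_le_pos _ _ e0 M_ge0; rewrite mxtrace_adjM.
apply: Rabs_sumR_le_ord => [|a]; first by apply: Rmult_le_pos => //; exact: pos_INR.
by apply: Rabs_sumR_le_ord => // b; apply: Rabs_mult_le => //; rewrite mxE.
Qed.

End MinorBounds.

Variables (r L C : R).
Hypotheses (L_ge0 : 0 <= L) (C_ge0 : 0 <= C).
Hypothesis lip_g : forall j a, lip_bounded (@open_ball n r) L (fun x => g j x a).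

Lemma jacobian_le (j : 'I_q) (D : 'I_n -> 'I_n -> R) (x : 'I_n -> R) (a b : 'I_n) :
  open_ball r x -> frechet (g j) x D -> Rabs (D a b) <= L.
Proof.
move=> rx fD; have [_ lip] := lip_g j a; apply: (frechet_coef_le b fD (r := r - norm2 x)).
  by rewrite /open_ball in rx; lra.
by move=> y yx; apply: lip => //; have := norm2_vsub_le y x; rewrite /open_ball; lra.
Qed.

Lemma cofactors_bounded p :
  exists M, 0 <= M /\ forall x (J : p.-tuple 'I_q) (K : p.-tuple 'I_n) a b,
    open_ball r x -> Rabs (cofactor (minor_mx g J K x) a b) <= M.
Proof.
pose T := (p.-tuple 'I_q * p.-tuple 'I_n * ('I_p * 'I_p))%type.
have [||M [M_ge0 M_bound]] := @exists_common_bound T (fun k M => forall x, open_ball r x ->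
    Rabs (cofactor (minor_mx g k.1.1 k.1.2 x) k.2.1 k.2.2) <= M).
- by move=> k c c' cc' c_bound x rx; apply: Rle_trans (c_bound x rx) cc'.
- move=> [[J K] [a b]]; have [|M [bM _]] := @ex_lip_bounded_cofactor n (@open_ball n r) p
    (minor_mx g J K) a b; last by exists M.
  by move=> i j; exists L; apply: lip_bounded_ext (lip_g (tnth J j) (tnth K i)) => x; rewrite !mxE.
- by exists M; split=> // x J K a b; exact: (M_bound (J, K, (a, b))).
Qed.

Lemma minor_velocity_le p : exists c, 0 <= c /\
  forall (x : 'I_n -> R) (u : 'I_q -> R) (w : 'I_n -> R) (e : R),
  open_ball r x -> brackets_spanned C x ->
  (forall j, Rabs (u j) <= 1) -> (forall b, Rabs (w b) <= e) -> 0 <= e ->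
  exists D, (forall k, frechet (g k) x (D k)) /\
  forall (J : p.-tuple 'I_q) (K : p.-tuple 'I_n),
  Rabs (\tr (\adj (minor_mx g J K x) *m mxsub (tnth K) (tnth J)
    (fields_velocity D (fun b => \big[Rplus/0]_(j < q) (u j * g j x b) + w b))))%R
  <= c * (LamNorm g p x + e).
Proof.
have [M [M_ge0 cofM]] := cofactors_bounded p.
have [p0 q0 n0] : [/\ 0 <= INR p, 0 <= INR q & 0 <= INR n] by split; exact: pos_INR.
pose cX := INR q * L; pose cY := INR q * C.
have cX_ge0 : 0 <= cX by exact: Rmult_le_pos.
have cY_ge0 : 0 <= cY by exact: Rmult_le_pos.
pose cLam := INR p * (INR n * cX) + INR p * (INR q * cY).
pose cerr := INR p * (INR p * (INR n * (L * M))).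
have cLam_ge0 : 0 <= cLam by apply: Rplus_le_le_0_compat; do 2!apply: Rmult_le_pos => //.
have cerr_ge0 : 0 <= cerr by do 4!apply: Rmult_le_pos => //.
exists (cLam + cerr); split=> [|x u w e rx span u_le1 we e0]; first lra.
have [D [c [fD [cC bracketE]]]] := brackets_spanned_jacobians span.
exists D; split=> // J K; have DL k a b : Rabs (D k a b) <= L := jacobian_le a b rx (fD k).
have [X [Y [Xc [Yc XYE]]]] := involutive_velocity u_le1 L_ge0 DL C_ge0 cC bracketE.
rewrite fields_velocityD XYE mxsubD mulmxDr mxtraceD.
have Ec a k : Rabs (fields_velocity D w a k) <= INR n * (L * e).
  by rewrite mxE; apply: Rabs_sumR_le_ord => [|b]; [exact: Rmult_le_pos | exact: Rabs_mult_le].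
have nLe : 0 <= INR n * (L * e) by do 2!apply: Rmult_le_pos => //.
have main := mxtrace_adj_involutive_le (tnth K) (tnth J) x cX_ge0 Xc cY_ge0 Yc.
have error := mxtrace_adj_error_le nLe Ec M_ge0 (fun a b => cofM x J K a b rx).
apply: Rle_trans (Rabs_triang _ _) _.
apply: Rle_trans (Rplus_le_compat _ _ _ _ main error) _.
have := Rmult_le_pos _ _ cLam_ge0 e0; have := Rmult_le_pos _ _ cerr_ge0 (LamNorm_ge0 g p x).
by rewrite /cLam /cerr /cX /cY; lra.
Qed.

(* The error [w] in the velocity allows for fields evaluated along a nearby path. *)
Definition LamDiff_rate (p : nat) (c : R) : Prop :=
  forall (gam : R -> 'I_n -> R) (t : R) (u : 'I_q -> R) (w : 'I_n -> R) (e V : R),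
  open_ball r (gam t) -> brackets_spanned C (gam t) ->
  (forall j, Rabs (u j) <= 1) -> (forall b, Rabs (w b) <= e) -> 0 <= e ->
  (forall b, is_derive (fun s => gam s b) t (\big[Rplus/0]_(j < q) (u j * g j (gam t) b) + w b)) ->
  c * (LamNorm g p (gam t) + e) < V ->
  locally t (fun s => LamDiff g p (gam s) (gam t) <= V * Rabs (s - t)).

Lemma LamDiff_rate_le (p : nat) (c c' : R) : c <= c' -> LamDiff_rate p c -> LamDiff_rate p c'.
Proof.
move=> cc' rate gam t u w e V rt span u_le1 we e0 dgam cV; apply: rate dgam _ => //.
apply: Rle_lt_trans cV; apply: Rmult_le_compat_r => //.
by have := LamNorm_ge0 g p (gam t); lra.
Qed.

Lemma LamDiff_rate_exists p : exists c, 0 <= c /\ LamDiff_rate p c.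
Proof.
have [c [c_ge0 Hc]] := minor_velocity_le p; pose N := INR #|{: p.-tuple 'I_q * p.-tuple 'I_n}|.
have N_ge0 : 0 <= N by exact: pos_INR.
exists (N * c); split=> [|gam t u w e V rt span u_le1 we e0 dgam cV]; first exact: Rmult_le_pos.
have [D [fD dle]] := Hc _ u w e rt span u_le1 we e0.
pose dG := fields_velocity D (fun b => \big[Rplus/0]_(j < q) (u j * g j (gam t) b) + w b).
pose dY (JK : p.-tuple 'I_q * p.-tuple 'I_n) :=
  (\tr (\adj (minor_mx g JK.1 JK.2 (gam t)) *m mxsub (tnth JK.2) (tnth JK.1) dG))%R.
have dYIK (JK : p.-tuple 'I_q * p.-tuple 'I_n) :
    is_derive (fun s => YIK g JK.1 JK.2 (gam s)) t (dY JK).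
  apply: (is_derive_ext (fun s => \det (minor_mx g JK.1 JK.2 (gam s)))%R).
    by move=> s; rewrite YIKE.
  apply: is_derive_det => a b.
  apply: (is_derive_ext (fun s => g (tnth JK.1 b) (gam s) (tnth JK.2 a))) => [s|].
    by rewrite !mxE.
  by rewrite !mxE; apply: is_derive_frechet_comp.
apply: filter_imp (l2_increment_le dYIK (P := @incr_pair q n p) (V := V) _) => [s|].
  by rewrite LamDiffE.
apply: Rle_lt_trans cV; rewrite Rmult_assoc.
have Lam_ge0 := LamNorm_ge0 g p (gam t).
by apply: l2_le_card => [|JK _]; [apply: Rmult_le_pos; lra | exact: dle].
Qed.

End Involutive.

(** * Growth of functions outside a small set of times *)

Lemma le_linear_error (a b Z : R) :
  (forall kappa, 0 < kappa <= 1 -> a <= b + Z * kappa) -> a <= b.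
Proof.
move=> err; apply: Rle_plus_epsilon => eps eps0; have Z0 := Rabs_pos Z.
have S0 : 0 < 1 + eps + Rabs Z by lra.
pose kappa := eps / (1 + eps + Rabs Z).
have kappa0 : 0 < kappa by exact: Rdiv_lt_0_compat.
have kappaE : kappa * (1 + eps + Rabs Z) = eps by rewrite /kappa; field; lra.
have kappa1 : kappa <= 1 by apply: (Rmult_le_reg_r (1 + eps + Rabs Z)); lra.
have := err kappa (conj kappa0 kappa1).
by have := Rmult_le_compat_r _ _ _ (Rlt_le _ _ kappa0) (Rle_abs Z); nra.
Qed.

Lemma at_right_ex (t : R) (P : R -> Prop) :
  at_right t P -> exists d, 0 < d /\ forall s, t < s < t + d -> P s.
Proof.
move=> /locally_ball_ex [d [d0 Pd]]; exists d; split=> // s [ts sd].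
by apply: Pd => //; rewrite Rabs_pos_eq; lra.
Qed.

Lemma at_right_lt (t T : R) : t < T -> at_right t (fun s => t < s < T).
Proof.
move=> tT; apply: filter_imp (locally_ball t (_ : 0 < T - t)) => [s st ts|]; last lra.
by have := Rle_abs (s - t); lra.
Qed.

Lemma right_growth_le (w m : R -> R) (T : R) : 0 <= T ->
  (forall t, 0 < t <= T -> filterlim w (at_left t) (locally (w t))) ->
  (forall s t, 0 <= s -> s <= t -> t <= T -> m s <= m t) ->
  (forall t, 0 <= t < T -> at_right t (fun s => w s - w t <= m s - m t)) ->
  w T - w 0 <= m T - m 0.
Proof.
move=> T_ge0 wc m_mono growth; pose E t := 0 <= t <= T /\ w t - w 0 <= m t - m 0.
have E0 : E 0 by split; lra.
have [tau [tau_ub tau_lub]] : {l | is_lub E l}.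
  by apply: completeness; [exists T => t []; lra | exists 0].
have tau0 : 0 <= tau by exact: tau_ub.
have tauT : tau <= T by apply: tau_lub => t []; lra.
have Etau : E tau.
  split=> //; have [tau_pos|<-] := Rle_lt_or_eq_dec _ _ tau0; last lra.
  apply: Rle_plus_epsilon => eps eps0.
  have w_tau := wc tau (conj tau_pos tauT) _ (locally_ball (w tau) eps0).
  have [d [d0 near_tau]] := locally_ball_ex w_tau.
  have [t [Et taut]] : exists t, E t /\ tau - d < t.
    apply: NNPP => noE; suff : tau <= tau - d by lra.
    by apply: tau_lub => t Et; apply: Rnot_lt_le => taut; apply: noE; exists t.
  have [[t0 tT] Ewt] := Et; have ttau := tau_ub t Et.
  have [lt|<-] := Rle_lt_or_eq_dec _ _ ttau; last lra.
  have := near_tau t _ lt; rewrite Rabs_left; last lra.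
  by move=> /(_ ltac:(lra)) /Rabs_def2; have := m_mono t tau t0 ttau tauT; lra.
have [lt|<-] := Rle_lt_or_eq_dec _ _ tauT; last by case: Etau.
have [d [d0 near_tau]] := at_right_ex (growth tau (conj tau0 lt)).
pose s := Rmin T (tau + d / 2); have taus : tau < s by apply: Rmin_glb_lt; lra.
have sT : s <= T by exact: Rmin_l.
have sd : s <= tau + d / 2 by exact: Rmin_r.
suff : s <= tau by lra.
by apply: tau_ub; split; [lra | have := near_tau s ltac:(lra); case: Etau; lra].
Qed.

Definition upper_right_derivative_le (w : R -> R) (t V : R) : Prop :=
  forall V', V < V' -> at_right t (fun s => w s - w t <= V' * (s - t)).

Lemma upper_right_derivative_le_trans (w : R -> R) (t V V' : R) : V <= V' ->
  upper_right_derivative_le w t V -> upper_right_derivative_le w t V'.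
Proof. by move=> VV' wV V'' V''lt; apply: wV; lra. Qed.

Definition clamp (T s : R) : R := Rmax 0 (Rmin T s).

Lemma clamp_in T s : 0 <= T -> 0 <= clamp T s <= T.
Proof. by move=> T_ge0; rewrite /clamp /Rmax /Rmin; do 2!case: Rle_dec; lra. Qed.

Lemma clamp_id T s : 0 <= s <= T -> clamp T s = s.
Proof. by move=> sT; rewrite /clamp /Rmax /Rmin; do 2!case: Rle_dec; lra. Qed.

Lemma clamp_lipschitz T s t : Rabs (clamp T s - clamp T t) <= Rabs (s - t).
Proof.
rewrite /clamp /Rmin; case: (Rle_dec T s) => ?; case: (Rle_dec T t) => ?; rewrite /Rmax.
all: by do !case: Rle_dec => ?; rewrite /Rabs; do !case: Rcase_abs => ?; lra.
Qed.

Lemma continuity_lipschitz (f : R -> R) (L : R) : 0 <= L ->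
  (forall s t, f s - f t <= L * Rabs (s - t)) -> continuity f.
Proof.
move=> L_ge0 lipf t; apply/continuity_pt_locally => eps.
have d_gt0 : 0 < eps / (L + 1) by apply: Rdiv_lt_0_compat; [exact: cond_pos | lra].
apply: filter_imp (locally_ball t d_gt0) => s st.
apply: Rle_lt_trans (_ : L * Rabs (s - t) < eps).
  by apply: Rabs_le; have := lipf s t; have := lipf t s; rewrite (Rabs_minus_sym t s); lra.
have : (L + 1) * (eps / (L + 1)) = eps by field; lra.
by have := Rmult_lt_compat_l (L + 1) _ _ ltac:(lra) st; have := Rabs_pos (s - t); lra.
Qed.

(* Stated without absolute values, since exchanging [s] and [t] gives the other bound. *)
Definition lip_interval (T L : R) (w : R -> R) : Prop :=
  forall s t, 0 <= s <= T -> 0 <= t <= T -> w s - w t <= L * Rabs (s - t).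

Lemma lip_interval_continuity_clamp (T L : R) (w : R -> R) : 0 <= T -> 0 <= L ->
  lip_interval T L w -> continuity (fun s => w (clamp T s)).
Proof.
move=> T_ge0 L_ge0 lipw; apply: (continuity_lipschitz L_ge0) => s t.
apply: Rle_trans (lipw _ _ (clamp_in s T_ge0) (clamp_in t T_ge0)) _.
by apply: Rmult_le_compat_l => //; exact: clamp_lipschitz.
Qed.

Lemma lip_interval_left_continuous (T L : R) (w : R -> R) (t : R) : 0 <= L ->
  lip_interval T L w -> 0 < t <= T -> filterlim w (at_left t) (locally (w t)).
Proof.
move=> L_ge0 lipw [t_gt0 tT]; have T_ge0 : 0 <= T by lra.
rewrite -{2}(@clamp_id T t); last lra.
apply: (filterlim_ext_loc (fun s => w (clamp T s))).
  apply: filter_imp (locally_ball t t_gt0) => s st ts.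
  by rewrite clamp_id //; move: st; rewrite Rabs_left; lra.
apply: filterlim_filter_le_1 (filter_le_within _) _.
exact: (proj1 (continuity_pt_filterlim _ _) (lip_interval_continuity_clamp T_ge0 L_ge0 lipw t)).
Qed.

Lemma lip_interval_upper_right_derivative_le (T L : R) (w : R -> R) (t : R) :
  lip_interval T L w -> 0 <= t < T -> upper_right_derivative_le w t L.
Proof.
move=> wL tT V LV; apply: filter_imp (at_right_lt (proj2 tT)) => s ts.
have := wL s t ltac:(lra) ltac:(lra); rewrite Rabs_pos_eq; last lra.
by nra.
Qed.

Lemma locally_upper_right_derivative_le (w : R -> R) (t V : R) :
  (forall V', V < V' -> locally t (fun s => w s - w t <= V' * Rabs (s - t))) ->
  upper_right_derivative_le w t V.
Proof.
move=> wV V' VV'; apply: filter_imp (wV V' VV') => s wst ts.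
by rewrite Rabs_pos_eq in wst; lra.
Qed.

(* The outer Lebesgue measure of [Z] between [0] and [T] is at most [eta]: [m t] plays the role of
   the measure of a neighbourhood of [Z] up to time [t]. *)
Definition outer_length_le (T : R) (Z : R -> Prop) (eta : R) : Prop :=
  exists m : R -> R,
    (forall s t, 0 <= s -> s <= t -> t <= T -> m s <= m t) /\ m T - m 0 <= eta /\
    forall t, 0 <= t < T -> Z t -> at_right t (fun s => s - t <= m s - m t).

Lemma outer_length_le_sub (T eta : R) (Z Z' : R -> Prop) :
  (forall t, 0 <= t < T -> Z' t -> Z t) -> outer_length_le T Z eta -> outer_length_le T Z' eta.
Proof.
move=> sub [m [mono [mT gain]]]; exists m; split=> //; split=> // t tT /(sub t tT).
exact: gain.
Qed.

Lemma outer_length_leU (T eta eta' : R) (Z Z' : R -> Prop) :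
  outer_length_le T Z eta -> outer_length_le T Z' eta' ->
  outer_length_le T (fun t => Z t \/ Z' t) (eta + eta').
Proof.
move=> [m [mono [mT gain]]] [m' [mono' [m'T gain']]]; exists (fun t => m t + m' t).
split=> [s t s0 st tT|]; first by have := mono s t s0 st tT; have := mono' s t s0 st tT; lra.
split=> [|t tT [Zt|Zt]]; first lra.
  apply: filter_imp (filter_and _ _ (gain t tT Zt) (at_right_lt (proj2 tT))) => s [gs sT].
  by have := mono' t s ltac:(lra) ltac:(lra) ltac:(lra); lra.
apply: filter_imp (filter_and _ _ (gain' t tT Zt) (at_right_lt (proj2 tT))) => s [gs sT].
by have := mono t s ltac:(lra) ltac:(lra) ltac:(lra); lra.
Qed.

Lemma increment_le_off_small (w : R -> R) (T L V eta : R) (Z : R -> Prop) :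
  0 <= T -> 0 <= L -> 0 <= V ->
  (forall t, 0 < t <= T -> filterlim w (at_left t) (locally (w t))) ->
  (forall t, 0 <= t < T -> upper_right_derivative_le w t L) ->
  outer_length_le T Z eta ->
  (forall t, 0 <= t < T -> ~ Z t -> upper_right_derivative_le w t V) ->
  w T - w 0 <= V * T + L * eta.
Proof.
move=> T_ge0 L_ge0 V_ge0 wc wL [m [mono [mT gain]]] wV.
have eta0 : 0 <= eta by have := mono 0 T ltac:(lra) T_ge0 ltac:(lra); lra.
apply: (@le_linear_error _ _ (T + eta)) => delta [delta0 _].
apply: Rle_trans (_ : (V + delta) * T + (L + delta) * m T -
    ((V + delta) * 0 + (L + delta) * m 0) <= _); last by nra.
apply: (@right_growth_le w (fun t => (V + delta) * t + (L + delta) * m t)) => //.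
  by move=> s t s0 st tT; have := mono s t s0 st tT; nra.
move=> t tT; have lt := at_right_lt (proj2 tT).
have [Zt|nZt] := classic (Z t).
  have wLt := wL t tT (L + delta) ltac:(lra).
  apply: filter_imp (filter_and _ _ lt (filter_and _ _ wLt (gain t tT Zt))) => s [ts [wst gst]].
  by nra.
have wVt := wV t tT nZt (V + delta) ltac:(lra).
apply: filter_imp (filter_and _ _ lt wVt) => s [ts wst].
by have := mono t s ltac:(lra) ltac:(lra) ltac:(lra); nra.
Qed.

Lemma exp_weighted_increment_le (C t s a b delta : R) :
  0 <= C -> 0 <= t -> t <= s -> 0 <= a -> 0 <= delta -> b - a <= (C * a + delta) * (s - t) ->
  exp (- C * s) * b - exp (- C * t) * a <= delta * (s - t).
Proof.
move=> C_ge0 t0 ts a0 d0 ba.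
have expt : exp (- C * t) = exp (- C * s) * exp (C * (s - t)) by rewrite -exp_plus; congr exp; ring.
have exps0 := exp_pos (- C * s).
have exps1 : exp (- C * s) <= 1.
  have expsV : exp (- C * s) * exp (C * s) = 1 by rewrite -exp_plus -exp_0; congr exp; ring.
  by have := exp_ineq1_le (C * s); have := Rmult_le_pos C s C_ge0; nra.
have ba_e : exp (- C * s) * (b - a - C * a * (s - t)) <= exp (- C * s) * (delta * (s - t)).
  by apply: Rmult_le_compat_l; lra.
have del_e : exp (- C * s) * (delta * (s - t)) <= 1 * (delta * (s - t)).
  by apply: Rmult_le_compat_r => //; apply: Rmult_le_pos; lra.
have a_e : exp (- C * s) * a * (1 + C * (s - t)) <= exp (- C * s) * a * exp (C * (s - t)).
  by apply: Rmult_le_compat_l; [apply: Rmult_le_pos; lra | exact: exp_ineq1_le].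
by rewrite expt; lra.
Qed.

Lemma gronwall_off_small (f : R -> R) (T C L eta : R) (Z : R -> Prop) :
  0 <= T -> 0 <= C -> 0 <= L -> (forall t, 0 <= t <= T -> 0 <= f t) ->
  lip_interval T L f -> outer_length_le T Z eta ->
  (forall t, 0 <= t < T -> ~ Z t -> upper_right_derivative_le f t (C * f t)) ->
  f T <= exp (C * T) * (f 0 + L * eta).
Proof.
move=> T_ge0 C_ge0 L_ge0 f0 fL Zeta fV; pose w t := exp (- C * t) * f t.
have weighted t V : 0 <= t < T -> 0 <= V -> upper_right_derivative_le f t (C * f t + V) ->
    upper_right_derivative_le w t V.
  move=> tT V_ge0 fCV V' VV'.
  have fCVt := fCV (C * f t + V') ltac:(lra).
  apply: filter_imp (filter_and _ _ (at_right_lt (proj2 tT)) fCVt) => s [ts fst].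
  by apply: exp_weighted_increment_le => //; try lra; apply: f0; lra.
have : w T - w 0 <= 0 * T + L * eta.
  apply: (@increment_le_off_small w _ _ _ _ Z) => //; first exact: Rle_refl.
  - move=> t tT.
    have fc := lip_interval_left_continuous L_ge0 fL tT.
    apply: (filterlim_comp_2 _ _ Rmult _ fc (filterlim_mult (K := R_AbsRing) _ _)).
    apply: filterlim_filter_le_1 (filter_le_within _) _.
    by apply: (ex_derive_continuous (fun s => exp (- C * s))); auto_derive.
  - move=> t tT; apply: weighted => //; apply: (@upper_right_derivative_le_trans _ _ L).
      by have := Rmult_le_pos _ _ C_ge0 (f0 t ltac:(lra)); lra.
    exact: lip_interval_upper_right_derivative_le fL tT.
  - move=> t tT nZt; apply: weighted => //; first exact: Rle_refl.
    by rewrite Rplus_0_r; exact: fV.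
have expT : exp (C * T) * exp (- C * T) = 1 by rewrite -exp_plus -exp_0; congr exp; ring.
rewrite /w Rmult_0_r exp_0 => growth; have := exp_pos (C * T).
have := Rmult_le_compat_l (exp (C * T)) _ _ (Rlt_le _ _ (exp_pos _)) growth.
by rewrite Rmult_minus_distr_l -Rmult_assoc expT; lra.
Qed.

(** * Translates of a path that avoid a null set *)

Lemma is_derive_continuity (f df : R -> R) : (forall x, is_derive f x (df x)) -> continuity f.
Proof.
move=> dF x; apply: derivable_continuous_pt; apply: ex_derive_Reals_0.
by exists (df x); exact: dF.
Qed.

Lemma ex_RInt_continuity (f : R -> R) (a b : R) : continuity f -> ex_RInt f a b.
Proof. by move=> cf; apply: ex_RInt_continuous => z _; apply/continuity_pt_filterlim. Qed.

Lemma continuity_shift (f gam : R -> R) (y : R) :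
  continuity f -> continuity gam -> continuity (fun s => f (y + gam s)).
Proof.
move=> cf cgam s; apply: (continuity_pt_comp (fun s => y + gam s) f); last exact: cf.
by apply: continuity_pt_plus; [exact: continuity_pt_const | exact: cgam].
Qed.

Lemma continuity_sumR (m : nat) (F : nat -> R -> R) :
  (forall k, continuity (F k)) -> continuity (fun x => \big[Rplus/0]_(k < m) F k x).
Proof. by move=> cF; apply: continuity_sum => i _; exact: cF. Qed.

Lemma continuity_prodR (I : Type) (r : seq I) (F : I -> R -> R) :
  (forall i, continuity (F i)) -> continuity (fun x => \big[Rmult/1]_(i <- r) F i x).
Proof.
move=> cF; elim: r => [|i r IH].
  apply: (continuity_eq (f := fun=> 1)) => [x|x]; first by rewrite big_nil.
  exact: continuity_pt_const.
apply: (continuity_eq (f := fun x => F i x * \big[Rmult/1]_(i <- r) F i x)) => [x|x].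
  by rewrite big_cons.
by apply: continuity_pt_mult; [exact: cF | exact: IH].
Qed.

Lemma ValAdh_le (u : nat -> R) (y : R) (f : R -> R) (c : R) (N : nat) :
  ValAdh u y -> continuity f -> (forall p, leq N p -> f (u p) <= c) -> f y <= c.
Proof.
move=> adh cf fu; apply: Rnot_lt_le => cfy.
have [d near_y] := proj1 (continuity_pt_locally f y) (cf y) (mkposreal (f y - c) ltac:(lra)).
have [p [/leP Np up]] := adh (fun z => Rabs (z - y) < d) N ltac:(by exists d).
by have := fu p Np; have /Rabs_def2 := near_y _ up; rewrite /=; lra.
Qed.

(* By the mean value theorem each partial sum is at most [E] somewhere; a cluster point of these
   places works for all partial sums, which increase. *)
Lemma exists_average_point (G lam : nat -> R -> R) (c d E : R) : c < d ->
  (forall k x, is_derive (G k) x (lam k x)) -> (forall k, continuity (lam k)) ->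
  (forall k x, 0 <= lam k x) ->
  (forall m, \big[Rplus/0]_(k < m) (G k d - G k c) <= E * (d - c)) ->
  exists y, c <= y <= d /\ forall m, \big[Rplus/0]_(k < m) lam k y <= E.
Proof.
move=> cd dG clam lam0 GE.
have /functional_choice [y y_avg] : forall m, exists y,
    c <= y <= d /\ \big[Rplus/0]_(k < m) lam k y <= E.
  move=> m; have dS x : is_derive (fun x => \big[Rplus/0]_(k < m) G k x) x
      (\big[Rplus/0]_(k < m) lam k x) by apply: is_derive_sumR => k _; exact: dG.
  have [y [cyd Gy]] := MVT_gen _ c d _ (fun x _ => dS x) (fun x _ => is_derive_continuity dS x).
  exists y; rewrite Rmin_left ?Rmax_right in cyd; try lra.
  by split=> //; have := GE m; rewrite sumRB Gy; nra.
have [z adh] := Bolzano_Weierstrass y _ (compact_P3 c d) (fun m => proj1 (y_avg m)).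
have idc : continuity id by move=> x; exact: continuity_pt_id.
have cN : continuity (fun x => - x) by exact: continuity_opp idc.
exists z; split.
  split; last by apply: (ValAdh_le (N := 0) adh idc) => p _; case: (y_avg p); lra.
  suff : - z <= - c by lra.
  by apply: (ValAdh_le (N := 0) adh cN) => p _; case: (y_avg p); lra.
move=> m; apply: (ValAdh_le (N := m) adh (continuity_sumR _ clam)) => p mp.
apply: Rle_trans (proj2 (y_avg p)); exact: (@sumR_mono (fun k => lam k (y p))).
Qed.

Lemma is_derive_RInt_shift (psi gam Phi phi : R -> R) (T y : R) :
  continuity psi -> continuity gam -> continuity phi -> (forall z, is_derive Phi z (phi z)) ->
  is_derive (fun y => RInt (fun s => psi s * Phi (y + gam s)) 0 T) y
            (RInt (fun s => psi s * phi (y + gam s)) 0 T).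
Proof.
move=> cpsi cgam cphi dPhi.
have dshift s z : is_derive (fun u => psi s * Phi (u + gam s)) z (psi s * phi (z + gam s)).
  apply: is_derive_scal; rewrite -[phi _]Rmult_1_l.
  by apply: is_derive_comp; [exact: dPhi | auto_derive => //; ring].
rewrite (RInt_ext _ (fun s => Derive (fun u => psi s * Phi (u + gam s)) y)); last first.
  by move=> s _; rewrite (is_derive_unique _ _ _ (dshift s y)).
apply: (is_derive_RInt_param (fun y s => psi s * Phi (y + gam s))).
- by apply: filter_forall => z s _; exists (psi s * phi (z + gam s)).
- move=> s _.
  apply: (continuity_2d_pt_ext (fun u v => psi v * phi (u + gam v))) => [u v|].
    by rewrite (is_derive_unique _ _ _ (dshift v u)).
  apply: continuity_2d_pt_mult.
    exact: (continuity_1d_2d_pt_comp psi (fun _ v => v) _ _ (cpsi _) (continuity_2d_pt_id2 _ _)).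
  apply: (continuity_1d_2d_pt_comp phi (fun u v => u + gam v)); first exact: cphi.
  apply: continuity_2d_pt_plus; first exact: continuity_2d_pt_id1.
  exact: (continuity_1d_2d_pt_comp gam (fun _ v => v) _ _ (cgam _) (continuity_2d_pt_id2 _ _)).
- apply: filter_forall => z; apply: ex_RInt_continuity; apply: continuity_mult => //.
  by apply: continuity_shift => //; exact: is_derive_continuity dPhi.
Qed.

(* The Poisson kernel at height [r], scaled so as to exceed [1] on [(c - r, c + r)]; its total mass
   is then [2 * PI * r]. *)
Definition cauchy_bump (c r z : R) : R := 2 * r ^ 2 / (r ^ 2 + (z - c) ^ 2).

Definition cauchy_bump_primitive (c r z : R) : R := 2 * r * atan ((z - c) / r).

Definition cauchy_bump_derivative (c r z : R) : R :=
  - (2 * r ^ 2) * (2 * (z - c)) / (r ^ 2 + (z - c) ^ 2) ^ 2.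

Section CauchyBump.
Variables (c r : R).
Hypothesis r_gt0 : 0 < r.

Lemma cauchy_bump_denom_gt0 z : 0 < r ^ 2 + (z - c) ^ 2.
Proof. by have := pow_lt r 2 r_gt0; have := pow2_ge_0 (z - c); lra. Qed.

Lemma cauchy_bump_ge0 z : 0 <= cauchy_bump c r z.
Proof.
apply: Rmult_le_pos; first by have := pow2_ge_0 r; lra.
exact: Rlt_le (Rinv_0_lt_compat _ (cauchy_bump_denom_gt0 z)).
Qed.

Lemma cauchy_bump_gt1 z : Rabs (z - c) < r -> 1 < cauchy_bump c r z.
Proof.
move=> zr; have den := cauchy_bump_denom_gt0 z.
have zr2 : (z - c) ^ 2 < r ^ 2 by rewrite -(pow2_abs (z - c)); have := Rabs_pos (z - c); nra.
apply: (Rmult_lt_reg_r (r ^ 2 + (z - c) ^ 2)) => //.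
by rewrite /cauchy_bump; field_simplify; lra.
Qed.

Lemma is_derive_cauchy_bump_primitive z :
  is_derive (cauchy_bump_primitive c r) z (cauchy_bump c r z).
Proof.
rewrite /cauchy_bump_primitive; auto_derive => //; rewrite /cauchy_bump; field.
by split; [have := cauchy_bump_denom_gt0 z; lra | lra].
Qed.

Lemma cauchy_bump_primitive_osc z z' :
  cauchy_bump_primitive c r z - cauchy_bump_primitive c r z' <= 2 * PI * r.
Proof.
have := atan_bound ((z - c) / r); have := atan_bound ((z' - c) / r).
by rewrite /cauchy_bump_primitive; nra.
Qed.

Lemma is_derive_cauchy_bump z : is_derive (cauchy_bump c r) z (cauchy_bump_derivative c r z).
Proof.
have den := cauchy_bump_denom_gt0 z; rewrite /cauchy_bump /cauchy_bump_derivative.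
by auto_derive; [lra | field; lra].
Qed.

Lemma continuity_cauchy_bump : continuity (cauchy_bump c r).
Proof. exact: is_derive_continuity is_derive_cauchy_bump. Qed.

Lemma continuity_cauchy_bump_derivative : continuity (cauchy_bump_derivative c r).
Proof.
move=> z; have den := cauchy_bump_denom_gt0 z; apply: derivable_continuous_pt.
by apply: ex_derive_Reals_0; rewrite /cauchy_bump_derivative; auto_derive; nra.
Qed.

Lemma RInt_cauchy_bump_le T : RInt (cauchy_bump c r) 0 T <= 2 * PI * r.
Proof.
rewrite (is_RInt_unique _ _ _ _ (is_RInt_derive (cauchy_bump_primitive c r) _ _ _ _ _)).
- exact: cauchy_bump_primitive_osc.
- by move=> z _; exact: is_derive_cauchy_bump_primitive.
- by move=> z _; apply/continuity_pt_filterlim; exact: continuity_cauchy_bump.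
Qed.

Section Shift.
Variables (psi gam : R -> R) (T : R).
Hypotheses (cpsi : continuity psi) (psi0 : forall s, 0 <= psi s).
Hypotheses (cgam : continuity gam) (T_ge0 : 0 <= T).

Definition shifted_mass (y : R) : R := RInt (fun s => psi s * cauchy_bump c r (y + gam s)) 0 T.

Lemma continuity_shifted_mass : continuity shifted_mass.
Proof.
apply: (@is_derive_continuity _
  (fun y => RInt (fun s => psi s * cauchy_bump_derivative c r (y + gam s)) 0 T)) => y.
exact: is_derive_RInt_shift cpsi cgam continuity_cauchy_bump_derivative is_derive_cauchy_bump.
Qed.

Lemma shifted_mass_ge0 y : 0 <= shifted_mass y.
Proof.
apply: RInt_ge_0 => // [|s _]; last by apply: Rmult_le_pos => //; exact: cauchy_bump_ge0.
apply: ex_RInt_continuity; apply: continuity_mult => //.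
exact: continuity_shift continuity_cauchy_bump cgam.
Qed.

Definition shifted_mass_primitive (y : R) : R :=
  RInt (fun s => psi s * cauchy_bump_primitive c r (y + gam s)) 0 T.

Lemma is_derive_shifted_mass_primitive y :
  is_derive shifted_mass_primitive y (shifted_mass y).
Proof.
exact: is_derive_RInt_shift cpsi cgam continuity_cauchy_bump is_derive_cauchy_bump_primitive.
Qed.

Lemma shifted_mass_primitive_osc y y' :
  shifted_mass_primitive y - shifted_mass_primitive y' <= 2 * PI * r * RInt psi 0 T.
Proof.
have ex_prim z : ex_RInt (fun s => psi s * cauchy_bump_primitive c r (z + gam s)) 0 T.
  apply: ex_RInt_continuity; apply: continuity_mult => //; apply: continuity_shift => //.
  exact: is_derive_continuity is_derive_cauchy_bump_primitive.
have ex_psi := ex_RInt_continuity 0 T cpsi.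
have <- : RInt (fun s => scal (2 * PI * r) (psi s)) 0 T = 2 * PI * r * RInt psi 0 T.
  exact: RInt_scal.
have <- : RInt (fun s => minus (psi s * cauchy_bump_primitive c r (y + gam s))
    (psi s * cauchy_bump_primitive c r (y' + gam s))) 0 T =
    shifted_mass_primitive y - shifted_mass_primitive y' by exact: RInt_minus.
apply: RInt_le => //; first exact: ex_RInt_minus.
  exact: (ex_RInt_scal psi).
move=> s _; rewrite /minus /plus /opp /scal /= /mult /=.
have := Rmult_le_compat_l _ _ _ (psi0 s) (cauchy_bump_primitive_osc (y + gam s) (y' + gam s)).
by lra.
Qed.

End Shift.

End CauchyBump.

Lemma exists_shift_coordinate (psi : nat -> R -> R) (gam : R -> R) (c rho W : nat -> R)
    (T kappa E : R) : 0 <= T -> 0 < kappa ->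
  (forall k, continuity (psi k)) -> (forall k s, 0 <= psi k s) -> continuity gam ->
  (forall k, 0 < rho k) -> (forall k, 0 <= W k) ->
  (forall m, \big[Rplus/0]_(k < m) (rho k * W k * RInt (psi k) 0 T) <= E) ->
  exists y, 0 <= y <= kappa /\ forall m,
    \big[Rplus/0]_(k < m)
      (W k * RInt (fun s => psi k s * cauchy_bump (c k) (rho k) (y + gam s)) 0 T)
    <= 2 * PI / kappa * E.
Proof.
move=> T_ge0 kappa0 cpsi psi0 cgam rho0 W_ge0 sumE.
apply: (@exists_average_point
  (fun k y => W k * shifted_mass_primitive (c k) (rho k) (psi k) gam T y)
  (fun k y => W k * shifted_mass (c k) (rho k) (psi k) gam T y)) => //.
- by move=> k y; apply: is_derive_scal; exact: is_derive_shifted_mass_primitive.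
- by move=> k; apply: continuity_scal; exact: continuity_shifted_mass.
- by move=> k y; apply: Rmult_le_pos => //; exact: shifted_mass_ge0.
move=> m; apply: (@Rle_trans _ (\big[Rplus/0]_(k < m) (2 * PI * (rho k * W k * RInt (psi k) 0 T)))).
  apply: ler_sumR => k _.
  have osc := shifted_mass_primitive_osc (c k) (rho0 k) (cpsi k) (psi0 k) cgam T_ge0 kappa 0.
  by have := Rmult_le_compat_l _ _ _ (W_ge0 k) osc; lra.
rewrite -big_distrr /=; have pi0 := PI_RGT_0; have := Rmult_le_compat_l (2 * PI) _ _ _ (sumE m).
by rewrite (_ : 2 * PI / kappa * E * (kappa - 0) = 2 * PI * E); [apply; lra | field; lra].
Qed.

Section Translation.
Variables (n : nat) (gam : R -> 'I_n -> R) (c rho : nat -> 'I_n -> R) (T kappa : R).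
Hypotheses (T_ge0 : 0 <= T) (kappa_gt0 : 0 < kappa).
Hypotheses (cgam : forall i, continuity (fun s => gam s i)) (rho_gt0 : forall k i, 0 < rho k i).

Let box_bump (y : 'I_n -> R) (k : nat) (i : 'I_n) (s : R) : R :=
  cauchy_bump (c k i) (rho k i) (y i + gam s i).

Lemma exists_shift_coordinates (r : seq 'I_n) : uniq r ->
  forall (psi : nat -> R -> R) (E : R),
  (forall k, continuity (psi k)) -> (forall k s, 0 <= psi k s) ->
  (forall m, \big[Rplus/0]_(k < m) ((\big[Rmult/1]_(i <- r) rho k i) * RInt (psi k) 0 T) <= E) ->
  exists y : 'I_n -> R, (forall i, 0 <= y i <= kappa) /\ forall m,
    \big[Rplus/0]_(k < m) RInt (fun s => psi k s * \big[Rmult/1]_(i <- r) box_bump y k i s) 0 T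
    <= (2 * PI / kappa) ^ size r * E.
Proof.
elim: r => [_|l r IH /andP[lr ur]] psi E cpsi psi0 sumE.
  exists (fun=> 0); split=> [i|m]; first lra.
  rewrite Rmult_1_l; apply: Rle_trans (sumE m); apply: Req_le; apply: eq_bigr => k _.
  by rewrite big_nil Rmult_1_l; apply: RInt_ext => s _; rewrite big_nil Rmult_1_r.
have [||yl [yl0 sum_l]] := @exists_shift_coordinate psi (fun s => gam s l) (c ^~ l) (rho ^~ l)
    (fun k => \big[Rmult/1]_(i <- r) rho k i) T kappa E T_ge0 kappa_gt0 cpsi psi0 (cgam l)
    (rho_gt0 ^~ l).
- by move=> k; apply: prodR_ge0 => i _; exact: Rlt_le.
- by move=> m; apply: Rle_trans (sumE m); apply: Req_le; apply: eq_bigr => k _; rewrite big_cons.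
pose psi_l k s := psi k s * cauchy_bump (c k l) (rho k l) (yl + gam s l).
have [||y [y0 sum_r]] := IH ur psi_l _ _ _ sum_l.
- move=> k; apply: continuity_mult; first exact: cpsi.
  by apply: continuity_shift; [exact: continuity_cauchy_bump | exact: cgam].
- by move=> k s; apply: Rmult_le_pos => //; exact: cauchy_bump_ge0.
exists [eta y with l |-> yl]; split=> [i|m]; first by rewrite /=; case: ifP.
rewrite /= (Rmult_comm (2 * PI / kappa)) Rmult_assoc.
apply: Rle_trans (sum_r m); apply: Req_le; apply: eq_bigr => k _; apply: RInt_ext => s _.
rewrite big_cons /psi_l {1}/box_bump /= eqxx -Rmult_assoc; congr (_ * _).
by apply: eq_big_seq => i ir; rewrite /box_bump /=; case: eqP ir lr => // -> ->.
Qed.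

Lemma exists_translation (E : R) :
  (forall m, \big[Rplus/0]_(k < m) \big[Rmult/1]_(i < n) rho k i <= E) ->
  exists y : 'I_n -> R, (forall i, 0 <= y i <= kappa) /\ forall m,
    \big[Rplus/0]_(k < m) RInt (fun s => \big[Rmult/1]_(i < n) box_bump y k i s) 0 T
    <= (2 * PI / kappa) ^ n * (T * E).
Proof.
move=> sumE; have [|||y [y0 sum_y]] :=
    @exists_shift_coordinates (index_enum 'I_n) (index_enum_uniq _) (fun _ _ => 1) (T * E).
- by move=> k; apply: continuity_const.
- by move=> *; lra.
- move=> m; rewrite RInt_const (_ : scal (T - 0) 1 = T); last by rewrite /scal /= /mult /=; ring.
  by rewrite -big_distrl /= Rmult_comm; exact: Rmult_le_compat_l (sumE m).
exists y; split=> // m; have := sum_y m.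
have -> : size (index_enum 'I_n) = n by rewrite -[RHS]card_ord cardE enumT.
apply: Rle_trans; apply: Req_le; apply: eq_bigr => k _; apply: RInt_ext => s _.
by rewrite Rmult_1_l.
Qed.

End Translation.

Lemma sum_n_big (a : nat -> R) (m : nat) : sum_n a m = \big[Rplus/0]_(k < m.+1) a k.
Proof.
elim: m => [|m IH]; first by rewrite sum_O big_ord_recl big_ord0 Rplus_0_r.
by rewrite sum_Sn IH [RHS]big_ord_recr.
Qed.

Section NonnegSeries.
Variables (a : nat -> R) (E : R).
Hypotheses (a0 : forall k, 0 <= a k) (aE : forall m, \big[Rplus/0]_(k < m) a k <= E).

Lemma ex_series_bounded : ex_series a.
Proof.
apply: (ex_finite_lim_seq_incr _ E) => m; rewrite !sum_n_big //.
by apply: sumR_mono.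
Qed.

Lemma is_lim_seq_Series : is_lim_seq (sum_n a) (Series a).
Proof. exact: Series_correct ex_series_bounded. Qed.

Lemma Series_le_bound : Series a <= E.
Proof.
have := is_lim_seq_le (sum_n a) (fun=> E) (Series a) E _ is_lim_seq_Series.
by apply=> [m|]; [rewrite sum_n_big | exact: is_lim_seq_const].
Qed.

Lemma le_Series k : a k <= Series a.
Proof.
have lim := proj1 (is_lim_seq_incr_n _ k _) is_lim_seq_Series.
apply: (is_lim_seq_le (fun=> a k) _ (a k) (Series a) _ (is_lim_seq_const _) lim) => m.
rewrite sum_n_big; have km : (k < (m + k).+1)%nat by rewrite ltnS leq_addl.
exact: (@sumR_ge_term _ xpredT (fun j : 'I_(m + k).+1 => a j) (Ordinal km)).
Qed.

End NonnegSeries.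

Lemma outer_length_le_cover (beta : nat -> R -> R) (T E : R) : 0 <= T ->
  (forall k, continuity (beta k)) -> (forall k s, 0 <= beta k s) ->
  (forall m, \big[Rplus/0]_(k < m) RInt (beta k) 0 T <= E) ->
  outer_length_le T (fun t => exists k, 1 < beta k t) E.
Proof.
move=> T_ge0 cb b0 sumE.
have ex_int k a b : ex_RInt (beta k) a b by exact: ex_RInt_continuity.
have int_ge0 k a b : a <= b -> 0 <= RInt (beta k) a b by move=> ab; exact: RInt_ge_0.
have Chasles k s t : RInt (beta k) 0 t - RInt (beta k) 0 s = RInt (beta k) s t.
  by rewrite -(RInt_Chasles (beta k) 0 s t) // /plus /=; ring.
have int_le a b m : 0 <= a -> a <= b -> b <= T -> \big[Rplus/0]_(k < m) RInt (beta k) a b <= E.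
  move=> a0 ab bT; apply: Rle_trans (sumE m); apply: ler_sumR => k _.
  have := Chasles k a b; have := Chasles k b T.
  by have := int_ge0 k b T bT; have := int_ge0 k 0 a a0; lra.
have ex_series_int a b : 0 <= a -> a <= b -> b <= T -> ex_series (fun k => RInt (beta k) a b).
  by move=> a0 ab bT; apply: (@ex_series_bounded _ E) => [k|m]; [exact: int_ge0 | exact: int_le].
pose m t := Series (fun k => RInt (beta k) 0 t).
have m_incrE s t : 0 <= s -> s <= t -> t <= T -> m t - m s = Series (fun k => RInt (beta k) s t).
  move=> s0 st tT; rewrite -Series_minus; try (apply: ex_series_int; lra).
  exact: Series_ext.
have gain k s t : 0 <= s -> s <= t -> t <= T -> RInt (beta k) s t <= m t - m s.
  move=> s0 st tT; rewrite m_incrE //; apply: (@le_Series (fun k => RInt (beta k) s t) E) => [j|j].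
    exact: int_ge0.
  exact: int_le.
exists m; split=> [s t s0 st tT|].
  by have := gain 0%nat s t s0 st tT; have := int_ge0 0%nat s t st; lra.
split=> [|t tT [k bt]].
  by rewrite m_incrE //; [apply: Series_le_bound => // k; exact: int_ge0 | lra | lra].
have bt0 : 0 < beta k t - 1 by lra.
have beta_t := proj1 (continuity_pt_locally _ _) (cb k t) (mkposreal _ bt0).
have [d [d0 near_t]] := locally_ball_ex beta_t.
have td : t < t + d by lra.
apply: filter_imp (filter_and _ _ (at_right_lt (proj2 tT)) (at_right_lt td)) => s [ts sd].
apply: Rle_trans (gain k t s ltac:(lra) ltac:(lra) ltac:(lra)).
rewrite (_ : s - t = RInt (fun=> 1) t s); last by rewrite RInt_const /scal /= /mult /= Rmult_1_r.
apply: RInt_le => //; [lra | exact: ex_RInt_const | move=> z tzs].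
have zt : Rabs (z - t) < d by rewrite Rabs_pos_eq; lra.
by have /Rabs_def2 := near_t z zt; rewrite /=; lra.
Qed.

Lemma null_set_sub n (N N' : ('I_n -> R) -> Prop) :
  (forall x, N' x -> N x) -> null_set N -> null_set N'.
Proof.
move=> sub nullN eps eps0; have [a [b [ab [cov vol]]]] := nullN eps eps0.
by exists a, b; split=> //; split=> // x /sub; exact: cov.
Qed.

Lemma prodR_enlarge n (a : 'I_n -> R) (eps : R) : 0 < eps ->
  exists d, 0 < d /\ \big[Rmult/1]_(i < n) (a i + d) <= \big[Rmult/1]_(i < n) a i + eps.
Proof.
move=> eps0; have ca (i : 'I_n) : continuity (fun d => a i + d).
  by move=> z; apply: continuity_pt_plus; [exact: continuity_pt_const | exact: continuity_pt_id].
have [d [d0 near_0]] := locally_ball_ex (proj1 (continuity_pt_locally _ _)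
  (continuity_prodR (index_enum _) ca 0) (mkposreal eps eps0)).
exists (d / 2); split; first lra.
have prod0 : \big[Rmult/1]_(i < n) (a i + 0) = \big[Rmult/1]_(i < n) a i.
  by apply: eq_bigr => i _; exact: Rplus_0_r.
have /Rabs_def2 := near_0 (d / 2) ltac:(rewrite Rminus_0_r Rabs_pos_eq; lra).
by rewrite prod0 /=; lra.
Qed.

Lemma prodR_gt1 n (F : 'I_n -> R) : (0 < n)%nat -> (forall i, 1 < F i) ->
  1 < \big[Rmult/1]_(i < n) F i.
Proof.
case: n F => // n F _ F1; rewrite big_ord_recl.
have : 1 <= \big[Rmult/1]_(i < n) F (lift ord0 i).
  by apply: (big_ind (fun u => 1 <= u)) => [|u v|i _]; [lra | nra | exact: Rlt_le].
by have := F1 ord0; nra.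
Qed.

Lemma null_set_open_boxes n (N : ('I_n -> R) -> Prop) (eps : R) : null_set N -> 0 < eps ->
  exists c rho : nat -> 'I_n -> R, (forall k i, 0 < rho k i) /\
    (forall x, N x -> exists k, forall i, Rabs (x i - c k i) < rho k i) /\
    (forall m, \big[Rplus/0]_(k < m) \big[Rmult/1]_(i < n) rho k i <= eps).
Proof.
move=> nullN eps0; have [a [b [ab [cov vol]]]] := nullN (eps / 2) ltac:(lra).
pose slack k := eps / 2 * (1 / 2) ^ k.+1.
have slack0 k : 0 < slack k by apply: Rmult_lt_0_compat; [lra | apply: pow_lt; lra].
have /functional_choice [d d_slack] : forall k, exists d, 0 < d /\
    \big[Rmult/1]_(i < n) (b k i - a k i + d) <= \big[Rmult/1]_(i < n) (b k i - a k i) + slack k.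
  by move=> k; exact: prodR_enlarge.
exists a, (fun k i => b k i - a k i + d k); split; [|split].
- by move=> k i; have := ab k i; have := proj1 (d_slack k); lra.
- move=> x /cov [k x_box]; exists k => i; have := x_box i; have := proj1 (d_slack k).
  by move=> *; apply: Rabs_def1; lra.
move=> m; have slack_sum : \big[Rplus/0]_(k < m) slack k = eps / 2 * (1 - (1 / 2) ^ m).
  elim: m => [|m IH]; first by rewrite big_ord0 /=; lra.
  by rewrite big_ord_recr /= IH /slack /=; field.
apply: Rle_trans (_ : \big[Rplus/0]_(k < m)
  (\big[Rmult/1]_(i < n) (b k i - a k i) + slack k) <= _).
  by apply: ler_sumR => k _; case: (d_slack k).
rewrite big_split /= slack_sum; have half_m := pow_lt (1 / 2) m ltac:(lra).
apply: Rle_trans (Rplus_le_compat_r _ _ _ (Rlt_le _ _ (vol m))) _.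
by have := Rmult_lt_0_compat _ _ eps0 half_m; lra.
Qed.

Lemma null1_outer_length_le (N : R -> Prop) (T eta : R) : null1 N -> 0 <= T -> 0 < eta ->
  outer_length_le T N eta.
Proof.
move=> nullN T_ge0 eta0; have pi0 := PI_RGT_0.
have eps0 : 0 < eta / (2 * PI) by apply: Rdiv_lt_0_compat; lra.
have [c [rho [rho0 [cov vol]]]] := null_set_open_boxes nullN eps0.
apply: outer_length_le_sub (@outer_length_le_cover
    (fun k => cauchy_bump (c k ord0) (rho k ord0)) T eta T_ge0 _ _ _) => [t _ Nt|k|k s|m].
- by have [k t_box] := cov (fun=> t) Nt; exists k; apply: cauchy_bump_gt1.
- exact: continuity_cauchy_bump.
- exact: cauchy_bump_ge0.
rewrite (_ : eta = 2 * PI * (eta / (2 * PI))); last by field; lra.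
apply: Rle_trans (Rmult_le_compat_l (2 * PI) _ _ _ (vol m)); last lra.
rewrite big_distrr /=; apply: ler_sumR => k _; rewrite big_ord1; exact: RInt_cauchy_bump_le.
Qed.

Definition translate n (y : 'I_n -> R) (gam : R -> 'I_n -> R) (s : R) : 'I_n -> R :=
  fun i => y i + gam s i.

Lemma vsub_translate n (y : 'I_n -> R) (gam : R -> 'I_n -> R) (s t : R) :
  vsub (translate y gam s) (translate y gam t) = vsub (gam s) (gam t).
Proof. by apply: functional_extensionality => i; rewrite /vsub /translate; ring. Qed.

Lemma vsub_translate_path n (y : 'I_n -> R) (gam : R -> 'I_n -> R) (s : R) :
  vsub (translate y gam s) (gam s) = y.
Proof. by apply: functional_extensionality => i; rewrite /vsub /translate; ring. Qed.

Lemma null_set_translate_continuous n (N : ('I_n -> R) -> Prop) (gam : R -> 'I_n -> R)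
    (T kappa eta : R) :
  (0 < n)%nat -> null_set N -> (forall i, continuity (fun s => gam s i)) ->
  0 <= T -> 0 < kappa -> 0 < eta ->
  exists y, norm2 y <= kappa /\ outer_length_le T (fun t => N (translate y gam t)) eta.
Proof.
move=> n0 nullN cgam T_ge0 kappa0 eta0; have n1 : 0 < INR n by apply: lt_0_INR; apply/ltP.
have kn0 : 0 < kappa / INR n by exact: Rdiv_lt_0_compat.
pose A := (2 * PI / (kappa / INR n)) ^ n * T.
have A_ge0 : 0 <= A.
  apply: Rmult_le_pos => //; apply: pow_le; apply: Rlt_le; apply: Rdiv_lt_0_compat => //.
  by have := PI_RGT_0; lra.
have eps0 : 0 < eta / (A + 1) by apply: Rdiv_lt_0_compat; lra.
have [c [rho [rho0 [cov vol]]]] := null_set_open_boxes nullN eps0.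
have [y [y0 sum_y]] := exists_translation c T_ge0 kn0 cgam rho0 vol; exists y; split.
  rewrite (_ : kappa = INR n * (kappa / INR n)); last by field; lra.
  by apply: norm2_le_dim => [|i]; [lra | rewrite Rabs_pos_eq; have := y0 i; lra].
have cbump k i : continuity (fun s => cauchy_bump (c k i) (rho k i) (y i + gam s i)).
  by apply: continuity_shift => //; exact: continuity_cauchy_bump.
have cprod k := continuity_prodR (index_enum _) (cbump k).
apply: outer_length_le_sub (outer_length_le_cover T_ge0 cprod _ _).
- move=> t tT /cov [k t_box]; exists k; apply: prodR_gt1 => // i.
  by apply: cauchy_bump_gt1; [exact: rho0 | exact: t_box].
- by move=> k s; apply: prodR_ge0 => i _; exact: cauchy_bump_ge0.
move=> m; apply: Rle_trans (sum_y m) _; rewrite -Rmult_assoc -/A.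
by rewrite (_ : A * _ = eta - eta / (A + 1)); [lra | field; lra].
Qed.

Definition lip_path n (T L : R) (gam : R -> 'I_n -> R) : Prop :=
  forall s t, 0 <= s <= T -> 0 <= t <= T -> norm2 (vsub (gam s) (gam t)) <= L * Rabs (s - t).

Lemma lip_path_coord n (T L : R) (gam : R -> 'I_n -> R) (i : 'I_n) :
  lip_path T L gam -> lip_interval T L (fun s => gam s i).
Proof.
move=> lip s t sT tT; apply: Rle_trans (lip s t sT tT).
exact: Rle_trans (Rle_abs _) (Rabs_le_norm2 (vsub (gam s) (gam t)) i).
Qed.

Lemma null_set_translate n (N : ('I_n -> R) -> Prop) (gam : R -> 'I_n -> R) (T L kappa eta : R) :
  (0 < n)%nat -> null_set N -> 0 <= T -> 0 <= L -> lip_path T L gam -> 0 < kappa -> 0 < eta ->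
  exists y, norm2 y <= kappa /\ outer_length_le T (fun t => N (translate y gam t)) eta.
Proof.
move=> n0 nullN T_ge0 L_ge0 lip kappa0 eta0.
have [y [yk len]] := null_set_translate_continuous n0 nullN
  (fun i => lip_interval_continuity_clamp T_ge0 L_ge0 (lip_path_coord i lip)) T_ge0 kappa0 eta0.
exists y; split=> //; apply: outer_length_le_sub len => t tT.
by rewrite /translate clamp_id //; lra.
Qed.

(** * Gronwall's inequality along subunit paths *)

Section SubunitPaths.
Variables (q n : nat) (g : 'I_q -> ('I_n -> R) -> ('I_n -> R)).

Definition subunit_velocity (gam : R -> 'I_n -> R) (t : R) : Prop :=
  exists u : 'I_q -> R, norm2 u <= 1 /\ forall a : 'I_n,
    derivable_pt_lim (fun s => gam s a) t (\big[Rplus/0]_(j < q) (u j * g j (gam t) a)).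

Lemma subunit_lip_path (T : R) (gam : R -> 'I_n -> R) :
  subunit g T gam -> exists L, 0 <= L /\ lip_path T L gam.
Proof.
move=> [[L lip] _]; exists (Rabs L); split=> [|s t sT tT]; first exact: Rabs_pos.
apply: Rle_trans (lip s t sT tT) _.
by apply: Rmult_le_compat_r; [exact: Rabs_pos | exact: Rle_abs].
Qed.

Lemma subunit_sub (T T' : R) (gam : R -> 'I_n -> R) :
  T' <= T -> subunit g T gam -> subunit g T' gam.
Proof.
move=> TT' [[L lip] null]; split; first by exists L => s t sT tT; apply: lip; lra.
by apply: null_set_sub null => x [xT vel]; split=> //; lra.
Qed.

Lemma subunit_outer_length_le (T eta : R) (gam : R -> 'I_n -> R) :
  subunit g T gam -> 0 <= T -> 0 < eta ->
  outer_length_le T (fun s => ~ subunit_velocity gam s) eta.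
Proof.
move=> [_ null] T_ge0 eta0; apply: outer_length_le_sub (null1_outer_length_le null T_ge0 eta0).
by move=> s st nvel; split=> //; lra.
Qed.

Variables (r L : R).
Hypotheses (L_ge0 : 0 <= L) (lip_g : forall j a, lip_bounded (@open_ball n r) L (fun x => g j x a)).

Lemma subunit_confined (T : R) (gam : R -> 'I_n -> R) :
  norm2 (gam 0) + 1 <= r -> subunit g T gam -> 0 <= T ->
  INR n * (INR q * L) * T < 1 -> norm2 (vsub (gam T) (gam 0)) < 1.
Proof.
pose V := INR n * (INR q * L); rewrite -/V.
move=> gam0 sub T_ge0 VT; have [Lg [Lg_ge0 lip]] := subunit_lip_path sub.
have qL_ge0 : 0 <= INR q * L by apply: Rmult_le_pos => //; exact: pos_INR.
have V_ge0 : 0 <= V by apply: Rmult_le_pos => //; exact: pos_INR.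
(* Truncated at [1], the distance cannot grow once the path leaves the ball. *)
pose w s := Rmin 1 (norm2 (vsub (gam s) (gam 0))).
have w0 : w 0 = 0 by rewrite /w norm2_vsubxx Rmin_right; lra.
have wdist s t : w s - w t <= norm2 (vsub (gam s) (gam t)).
  have := norm2_triangle (gam s) (gam t) (gam 0); have := norm2_ge0 (vsub (gam s) (gam t)).
  by rewrite /w /Rmin; do 2!case: Rle_dec; lra.
have wlip : lip_interval T Lg w by move=> s t sT tT; apply: Rle_trans (wdist s t) _; exact: lip.
suff : w T <= V * T by rewrite /w /Rmin; case: Rle_dec; lra.
apply: (@le_linear_error _ _ Lg) => eta [eta0 _].
suff : w T - w 0 <= V * T + Lg * eta by lra.
apply: (@increment_le_off_small w _ _ _ _ (fun s => ~ subunit_velocity gam s)) => //.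
- by move=> t tT; exact: lip_interval_left_continuous Lg_ge0 wlip tT.
- by move=> t; exact: lip_interval_upper_right_derivative_le.
- exact: subunit_outer_length_le.
move=> t tT /NNPP [u [u_le1 du]]; apply: locally_upper_right_derivative_le => V' VV'.
have [near|far] := Rlt_le_dec (norm2 (vsub (gam t) (gam 0))) 1; last first.
  apply: filter_forall => s; have -> : w t = 1 by rewrite /w Rmin_left.
  by have := Rmin_l 1 (norm2 (vsub (gam s) (gam 0))); have := Rabs_pos (s - t); rewrite /w; nra.
have ball_t : open_ball r (gam t).
  by have := norm2_vsub_le (gam t) (gam 0); rewrite /open_ball; lra.
have dgam a := proj2 (is_derive_Reals _ _ _) (du a).
apply: filter_imp (l2_increment_le (P := xpredT) dgam _) => [s|].
  exact: Rle_trans (wdist s t).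
apply: Rle_lt_trans VV'; apply: norm2_le_dim => [|a].
  by apply: Rmult_le_pos => //; exact: pos_INR.
apply: Rabs_sumR_le_ord => // j; rewrite -(Rmult_1_l L); apply: Rabs_mult_le.
  exact: Rle_trans (Rabs_le_norm2 u j) u_le1.
exact: (proj1 (lip_g j a)).
Qed.

Lemma combination_dist_le (u : 'I_q -> R) (x y : 'I_n -> R) (kappa : R) (a : 'I_n) :
  (forall j, Rabs (u j) <= 1) -> open_ball r x -> open_ball r y -> norm2 (vsub x y) <= kappa ->
  Rabs (\big[Rplus/0]_(j < q) (u j * g j x a) - \big[Rplus/0]_(j < q) (u j * g j y a)) <=
  INR q * (L * kappa).
Proof.
move=> u_le1 rx ry xy; have kappa_ge0 := Rle_trans _ _ _ (norm2_ge0 _) xy.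
rewrite -sumRB; apply: Rabs_sumR_le_ord => [|j]; first exact: Rmult_le_pos.
rewrite -Rmult_minus_distr_l -[X in _ <= X]Rmult_1_l; apply: Rabs_mult_le => //.
by apply: Rle_trans (proj2 (lip_g j a) _ _ rx ry) _; exact: Rmult_le_compat_l.
Qed.

Variables (C c : R) (p : nat).
Hypotheses (c_ge0 : 0 <= c) (rate : LamDiff_rate g r C p c).

Section Translate.
Variables (LLam Lgam T kappa eta : R) (gam : R -> 'I_n -> R) (y : 'I_n -> R) (Z : R -> Prop).
Hypotheses (LLam_ge0 : 0 <= LLam) (Lgam_ge0 : 0 <= Lgam) (T_ge0 : 0 <= T).
Hypothesis lip_gam : lip_path T Lgam gam.
Hypothesis lip_Lam : forall x x', open_ball r x -> open_ball r x' ->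
  LamDiff g p x' x <= LLam * norm2 (vsub x' x).
Hypotheses (yk : norm2 y <= kappa) (len_Z : outer_length_le T Z eta).
Hypothesis ball_gam : forall t, 0 <= t <= T ->
  open_ball r (gam t) /\ open_ball r (translate y gam t).
Hypothesis good : forall t, 0 <= t < T -> ~ Z t ->
  subunit_velocity gam t /\ brackets_spanned g C (translate y gam t).

Let gamy := translate y gam.
Let err := INR q * (L * kappa).

Lemma LamDiff_translate_growth :
  LamDiff g p (gamy T) (gamy 0) + (LamNorm g p (gamy 0) + err) <=
  exp (c * T) * (LamNorm g p (gamy 0) + err + LLam * Lgam * eta).
Proof.
have kappa_ge0 : 0 <= kappa by apply: Rle_trans yk; exact: norm2_ge0.
have Lkappa_ge0 : 0 <= L * kappa by exact: Rmult_le_pos.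
have err_ge0 : 0 <= err by apply: Rmult_le_pos => //; exact: pos_INR.
have Lam_ge0 := LamNorm_ge0 g p (gamy 0).
pose f t := LamDiff g p (gamy t) (gamy 0) + (LamNorm g p (gamy 0) + err).
have fdist s t : f s - f t <= LamDiff g p (gamy s) (gamy t).
  by have := LamDiff_triangle g p (gamy s) (gamy t) (gamy 0); rewrite /f; lra.
have f0 : f 0 = LamNorm g p (gamy 0) + err by rewrite /f LamDiffxx Rplus_0_l.
rewrite -{2}f0; apply: (@gronwall_off_small f T c (LLam * Lgam) eta Z) => //.
- exact: Rmult_le_pos.
- by move=> t _; have := LamDiff_ge0 g p (gamy t) (gamy 0); rewrite /f; lra.
- move=> s t sT tT; apply: Rle_trans (fdist s t) _.
  have [_ bs] := ball_gam sT; have [_ bt] := ball_gam tT.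
  apply: Rle_trans (lip_Lam bt bs) _; rewrite vsub_translate Rmult_assoc.
  by apply: Rmult_le_compat_l => //; exact: lip_gam.
move=> t tT nZt; have [[u [u_le1 du]] span] := good tT nZt.
have [bt byt] := ball_gam (conj (proj1 tT) (Rlt_le _ _ (proj2 tT))).
have u_coord j : Rabs (u j) <= 1 by exact: Rle_trans (Rabs_le_norm2 u j) u_le1.
pose w a := \big[Rplus/0]_(j < q) (u j * g j (gam t) a) -
  \big[Rplus/0]_(j < q) (u j * g j (gamy t) a).
have w_err a : Rabs (w a) <= err.
  by apply: combination_dist_le => //; rewrite norm2_vsubC vsub_translate_path.
apply: locally_upper_right_derivative_le => V' fV'.
apply: filter_imp (rate byt span u_coord w_err err_ge0 (V := V') _ _) => [s|a|].
- exact: Rle_trans (fdist s t).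
- rewrite /w Rplus_minus; apply: (is_derive_ext (fun s => y a + gam s a)) => [//|].
  rewrite -[X in is_derive _ _ X]Rplus_0_l; apply: is_derive_plus; first exact: is_derive_const.
  exact/is_derive_Reals.
apply: Rle_lt_trans fV'; apply: Rmult_le_compat_l => //.
by rewrite -/(gamy t) /f; have := LamNorm_le_LamDiff g p (gamy 0) (gamy t); lra.
Qed.

End Translate.

Lemma subunit_gronwall (T : R) (gam : R -> 'I_n -> R) :
  (0 < n)%nat -> null_set (fun x => open_ball r x /\ ~ brackets_spanned g C x) ->
  subunit g T gam -> 0 <= T -> (forall t, 0 <= t <= T -> norm2 (gam t) + 1 < r) ->
  LamDiff g p (gam T) (gam 0) <= LamNorm g p (gam 0) * (exp (c * T) - 1).
Proof.
move=> n0 nullH sub T_ge0 gam_r; have [Lgam [Lgam_ge0 lip_gam]] := subunit_lip_path sub.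
have [|LLam [LLam_ge0 lip_Lam]] := @LamDiff_lipschitz _ _ g p (@open_ball n r).
  by move=> j a; exists L.
have exp_ge1 : 1 <= exp (c * T).
  by have := exp_ineq1_le (c * T); have := Rmult_le_pos _ _ c_ge0 T_ge0; lra.
pose Z := 2 * LLam + (exp (c * T) - 1) * (LLam + INR q * L) + exp (c * T) * (LLam * Lgam * 2).
apply: (@le_linear_error _ _ Z) => kappa [kappa_gt0 kappa_le1].
have [y [yk lenH]] := null_set_translate n0 nullH T_ge0 Lgam_ge0 lip_gam kappa_gt0 kappa_gt0.
have ball_gam t : 0 <= t <= T -> open_ball r (gam t) /\ open_ball r (translate y gam t).
  move=> /gam_r tr; have := norm2_vsub_le (translate y gam t) (gam t).
  by rewrite vsub_translate_path /open_ball; lra.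
have len := outer_length_leU lenH (subunit_outer_length_le sub T_ge0 kappa_gt0).
have near t : 0 <= t <= T -> LamDiff g p (translate y gam t) (gam t) <= LLam * kappa.
  move=> /ball_gam [bt byt]; apply: Rle_trans (lip_Lam _ _ bt byt) _.
  by rewrite vsub_translate_path; exact: Rmult_le_compat_l.
have good t : 0 <= t < T ->
    ~ ((open_ball r (translate y gam t) /\ ~ brackets_spanned g C (translate y gam t)) \/
       ~ subunit_velocity gam t) ->
    subunit_velocity gam t /\ brackets_spanned g C (translate y gam t).
  move=> tT /not_or_and [nbad /NNPP vel]; split=> //; apply: NNPP => nspan; apply: nbad.
  by split=> //; apply: (proj2 (ball_gam t _)); lra.
have growth :=
  LamDiff_translate_growth LLam_ge0 Lgam_ge0 T_ge0 lip_gam lip_Lam yk len ball_gam good.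
have near0 := near 0 ltac:(lra); have nearT := near T ltac:(lra).
have triT := LamDiff_triangle g p (gam T) (translate y gam T) (gam 0).
have tri0 := LamDiff_triangle g p (translate y gam T) (translate y gam 0) (gam 0).
have LamNorm_near := LamNorm_le_LamDiff g p (gam 0) (translate y gam 0).
rewrite (LamDiffC g p (gam T) (translate y gam T)) in triT.
have Lamy := Rle_trans _ _ _ LamNorm_near (Rplus_le_compat_r _ _ _ near0).
have := Rmult_le_compat_l (exp (c * T) - 1) _ _ ltac:(lra) Lamy.
by rewrite /Z; lra.
Qed.

End SubunitPaths.

Lemma condH_null_set q n (g : 'I_q -> ('I_n -> R) -> ('I_n -> R)) (r : R) : condH g ->
  exists C, 0 <= C /\ null_set (fun x => open_ball r x /\ ~ brackets_spanned g C x).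
Proof.
move=> condHg; have [C nullC] := condHg _ (@is_open_open_ball n r) (@is_bounded_open_ball n r).
exists (Rabs C); split; first exact: Rabs_pos.
apply: null_set_sub nullC => x [rx bad]; split=> // span; apply: bad.
exact: brackets_spanned_le (Rle_abs C) span.
Qed.

Lemma loc_lip_common_bound q n (g : 'I_q -> ('I_n -> R) -> ('I_n -> R)) (r : R) :
  (forall j, loc_lip (g j)) ->
  exists L, 0 <= L /\ forall j a, lip_bounded (@open_ball n r) L (fun x => g j x a).
Proof.
move=> lip; have [||L [L_ge0 L_bound]] := @exists_common_bound ('I_q * 'I_n)%type
    (fun ja L => lip_bounded (@open_ball n r) L (fun x => g ja.1 x ja.2)).
- by move=> ja L L'; exact: lip_bounded_le.
- by move=> ja; apply: loc_lip_ex_lip_bounded => //; exact: is_bounded_open_ball.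
by exists L; split=> // j a; exact: (L_bound (j, a)).
Qed.

Lemma LamDiff_subunit_le q n (g : 'I_q -> ('I_n -> R) -> ('I_n -> R)) (M : R) :
  (forall j, loc_lip (g j)) -> condH g ->
  exists C, 1 <= C /\ forall (T : R) (gam : R -> 'I_n -> R) (p : nat),
    (0 < n)%nat -> leq p q -> subunit g T gam -> norm2 (gam 0) <= M ->
    0 <= T -> C * T <= 1 ->
    LamDiff g p (gam T) (gam 0) <= LamNorm g p (gam 0) * (exp (C * T) - 1).
Proof.
move=> lip condHg; pose r := M + 2.
have [L [L_ge0 lip_g]] := loc_lip_common_bound r lip.
have [CH [CH_ge0 nullH]] := condH_null_set r condHg.
have [||c [c_ge0 rate]] := @exists_common_bound 'I_q.+1 (fun p c => LamDiff_rate g r CH p c).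
- by move=> p c c'; exact: LamDiff_rate_le.
- by move=> p; have [c [_ rate]] := LamDiff_rate_exists L_ge0 CH_ge0 lip_g p; exists c.
pose V := INR n * (INR q * L).
have V_ge0 : 0 <= V := Rmult_le_pos _ _ (pos_INR n) (Rmult_le_pos _ _ (pos_INR q) L_ge0).
exists (1 + V + c); split=> [|T gam p n0 pq sub gam0 T_ge0 CT]; first lra.
have cT := Rmult_le_pos _ _ c_ge0 T_ge0.
have confined t : 0 <= t <= T -> norm2 (gam t) + 1 < r.
  move=> tT; have VtT : V * t <= V * T by apply: Rmult_le_compat_l; lra.
  have Vt1 : V * t < 1 by have [->|t0] := Req_dec t 0; lra.
  have := norm2_vsub_le (gam t) (gam 0).
  have := subunit_confined L_ge0 lip_g _ (subunit_sub (proj2 tT) sub) (proj1 tT) Vt1.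
  by rewrite /r; move=> /(_ ltac:(lra)); lra.
apply: (subunit_gronwall L_ge0 lip_g _ _ n0 nullH) => //; first lra.
by have := rate (inord p); rewrite inordK //; apply: LamDiff_rate_le; lra.
Qed.

Theorem theorem2p3 (q n : nat) (g : 'I_q -> ('I_n -> R) -> ('I_n -> R))
  (Hlip : forall j : 'I_q, loc_lip (g j)) (HH : condH g)
  (Om : ('I_n -> R) -> Prop) (Hbd : is_bounded Om) :
  exists C : R, 0 < C /\
    forall (x : 'I_n -> R) (T : R) (gam : R -> 'I_n -> R),
      Om x -> subunit g T gam -> gam 0 = x ->
      forall p : nat, leq 1 p -> leq p (minn q n) ->
      forall t : R, 0 <= t <= Rmin T (/ C) ->
        LamDiff g p (gam t) x <= LamNorm g p x * (exp (C * t) - 1) /\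
        (forall I : p.-tuple 'I_q, incr_idx I ->
           YIDiff g I (gam t) x <= C * LamNorm g p x * (exp (C * t) - 1)).
Proof.
have [M OmM] := Hbd; have [C [C_ge1 LamC]] := LamDiff_subunit_le M Hlip HH.
exists C; split=> [|x T gam Omx sub gam0 p p1]; first lra.
have gamM : norm2 (gam 0) <= M by rewrite gam0; exact: OmM.
rewrite -{x Omx}gam0 leq_min => /andP[pq pn] t [t0 tTC].
have tT := Rle_trans _ _ _ tTC (Rmin_l _ _); have tC := Rle_trans _ _ _ tTC (Rmin_r _ _).
have Ct1 : C * t <= 1 by rewrite -(Rinv_r C); [apply: Rmult_le_compat_l; lra | lra].
have exp0 : 0 <= exp (C * t) - 1.
  by have := exp_ineq1_le (C * t); have := Rmult_le_pos C t ltac:(lra) t0; lra.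
have Lam : LamDiff g p (gam t) (gam 0) <= LamNorm g p (gam 0) * (exp (C * t) - 1).
  by apply: LamC => //; [exact: leq_trans pn | exact: subunit_sub tT sub].
split=> // I incI; apply: Rle_trans (YIDiff_le_LamDiff _ _ _ incI) _.
apply: Rle_trans Lam _; rewrite Rmult_assoc -[X in X <= _]Rmult_1_l.
apply: (Rmult_le_compat_r _ _ _ _ C_ge1).
by apply: Rmult_le_pos => //; exact: LamNorm_ge0.
Qed.
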